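(* Let $k$ be a field and let $\hat L$ be a finite atomic lattice. The squarefree minimal ideal $M(L)\subset k[L]$ has a linear resolution if and only if (i) $L$ is Cohen-Macaulay (over $k$) as a poset, and (ii) if $a,b\in\hat L$ and $b$ covers $a\ne\hat 0$, then $\deg x(b)=\deg x(a)+1$.
   Context: A finite atomic lattice $\hat L$ is a finite lattice with minimum $\hat 0$ and maximum $\hat 1$ in which every element is a join of atoms. $L=\hat L\setminus\{\hat 0,\hat 1\}$; $\operatorname{mi}(L)$ is the set of meet-irreducible elements of $L$, i.e. elements of $L$ covered by exactly one element of $\hat L$; $k[L]:=k[x_l: l\in\operatorname{mi}(L)]$; for $a\in\hat L$, $x(a):=\prod x_l$ over $l\in\operatorname{mi}(L)$ with $a\not\le l$; and $M(L):=(x(a): a\text{ an atom of }\hat L)$. A graded ideal $I$ has a linear resolution if there is $d$ such that the graded Betti numbers satisfy $\beta_{i,j}(I)=0$ unless $j=i+d$ (standard grading). A poset is Cohen-Macaulay over $k$ if its order complex is a Cohen-Macaulay simplicial complex over $k$ (for every face, the reduced homology with $k$-coefficients of its link vanishes below the dimension of the link). *)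

(* Defs.v *)
From HB Require Import structures.
From mathcomp Require Import all_boot all_order all_algebra.
From mathcomp Require Export mpoly.

Set Implicit Arguments.
Unset Strict Implicit.
Unset Printing Implicit Defensive.

Import Order.TTheory GRing.Theory.
Local Open Scope ring_scope.

Section FiniteLattice.
Context {disp : Order.disp_t} {T : finTBLatticeType disp}.

Definition covers (b a : T) : bool :=
  (a < b)%O && [forall c : T, ~~ ((a < c)%O && (c < b)%O)].

Definition atom (a : T) : bool := covers a \bot%O.

Definition atomic_lattice : Prop :=
  forall x : T, exists A : {set T},
    (forall a, a \in A -> atom a) /\ x = (\join_(a in A) a)%O.

Definition proper_part : {set T} :=
  [set x : T | (x != \bot%O) && (x != \top%O)].

(* The cover is taken in T, so it may be \top. *)
Definition meet_irr : {set T} :=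
  [set l in proper_part | #|[set u : T | covers u l]| == 1%N].

End FiniteLattice.

Arguments atomic_lattice {disp} T.
Arguments proper_part {disp} T.
Arguments meet_irr {disp} T.

(* Ideals are represented by their membership predicate. *)
Definition ideal_gen (S : comNzRingType) (A : pred S) (f : S) : Prop :=
  exists (s : seq (S * S)),
    all (fun cg => A cg.2) s /\ f = \sum_(cg <- s) cg.1 * cg.2.

Section MinimalIdeal.
Variables (k : fieldType) (disp : Order.disp_t) (T : finTBLatticeType disp).

(* The variable 'X_i stands for x_l, where l = enum_val i is the i-th element
   of meet_irr T. *)
Definition xmon (a : T) : {mpoly k[#|meet_irr T|]} :=
  \prod_(i < #|meet_irr T| | ~~ (a <= enum_val i)%O) 'X_i.

Definition minimal_ideal : {mpoly k[#|meet_irr T|]} -> Prop :=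
  ideal_gen [pred f | [exists a : T, atom a && (f == xmon a)]].

End MinimalIdeal.

Arguments xmon k {disp T} a.
Arguments minimal_ideal k {disp} T f.

(* Total degree; only meaningful for p != 0, since msize p = deg p + 1. *)
Definition total_degree (k : fieldType) (n : nat) (p : {mpoly k[n]}) : nat :=
  (msize p).-1.

Section GradedResolutions.
Variables (k : fieldType) (n : nat).
Local Notation S := {mpoly k[n]}.

(* An augmented sequence  ... -> F_1 -> F_0 -> S  of finitely generated graded
   free modules F_i = (+)_r S(- gf_deg i r).  Elements of F_i are row vectors
   and the maps act by multiplication on the right.  Natural-number shifts
   suffice: generators of a minimal resolution of an ideal of S live in
   nonnegative degrees. *)
Record graded_free_seq := GradedFreeSeq {
  gf_rank : nat -> nat;
  gf_deg  : forall i, 'I_(gf_rank i) -> nat;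
  gf_diff : forall i, 'M[S]_(gf_rank i.+1, gf_rank i);
  gf_aug  : 'cV[S]_(gf_rank 0)
}.

(* The maps have degree 0.  The second conjunct is needed because the
   subtraction in the first one is truncated. *)
Definition gf_homogeneous (F : graded_free_seq) : Prop :=
  (forall r, gf_aug F r ord0 \is (@gf_deg F 0 r).-homog) /\
  (forall i r c,
     gf_diff F i r c \is (@gf_deg F i.+1 r - @gf_deg F i c)%N.-homog /\
     (gf_diff F i r c != 0 -> (@gf_deg F i c <= @gf_deg F i.+1 r)%N)).

Definition gf_resolves (F : graded_free_seq) (I : S -> Prop) : Prop :=
  [/\ forall f, I f <-> exists v : 'rV[S]_(gf_rank F 0), v *m gf_aug F = f%:M,
      forall v : 'rV[S]_(gf_rank F 0),
        v *m gf_aug F = 0 <-> exists w, v = w *m gf_diff F 0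
    & forall i (v : 'rV[S]_(gf_rank F i.+1)),
        v *m gf_diff F i = 0 <-> exists w, v = w *m gf_diff F i.+1].

(* F_{i+1} maps into (x_1, ..., x_n) F_i. *)
Definition gf_minimal (F : graded_free_seq) : Prop :=
  forall i r c, (gf_diff F i r c)@_0%MM = 0.

Definition minimal_graded_free_resolution
    (F : graded_free_seq) (I : S -> Prop) : Prop :=
  [/\ gf_homogeneous F, gf_resolves F I & gf_minimal F].

(* graded_betti I i j b  means  beta_{i,j}(I) = b. *)
Definition graded_betti (I : S -> Prop) (i j b : nat) : Prop :=
  exists F, minimal_graded_free_resolution F I /\
    b = #|[set r : 'I_(gf_rank F i) | gf_deg r == j]|.

Definition has_linear_resolution (I : S -> Prop) : Prop :=
  exists d : nat, forall i j : nat, j <> (i + d)%N -> graded_betti I i j 0.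

End GradedResolutions.

Section SimplicialComplexes.
Variables (k : fieldType) (V : finType).
Implicit Types (K : {set {set V}}) (F G : {set V}).

Definition link K F : {set {set V}} :=
  [set G : {set V} | [disjoint F & G] && (F :|: G \in K)].

(* dim K + 1. *)
Definition max_face_size K : nat := \max_(G in K) #|G|.

(* Chains of K of dimension p - 1, i.e. on the faces with p vertices; the empty
   face is included, so that the homology is reduced. *)
Definition is_chain K (p : nat) (c : {ffun {set V} -> k}) : Prop :=
  forall G, c G != 0 -> (G \in K) && (#|G| == p).

(* Faces are oriented by the enumeration order of V. *)
Definition boundary (c : {ffun {set V} -> k}) : {ffun {set V} -> k} :=
  [ffun G : {set V} => \sum_(v | v \notin G)
     (-1) ^+ #|[set w in G | (enum_rank w < enum_rank v)%N]| * c (v |: G)].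

(* The reduced homology of K in degree p - 1 is zero. *)
Definition reduced_homology_vanishes K (p : nat) : Prop :=
  forall z, is_chain K p z -> boundary z = 0 ->
    exists c, is_chain K p.+1 c /\ boundary c = z.

(* For p = q + 1, the condition p < max_face_size is q < dim. *)
Definition cohen_macaulay_complex K : Prop :=
  forall F, F \in K -> forall p : nat,
    (p < max_face_size (link K F))%N -> reduced_homology_vanishes (link K F) p.

End SimplicialComplexes.

Definition order_complex (disp : Order.disp_t) (T : finPOrderType disp)
    (P : {set T}) : {set {set T}} :=
  [set C : {set T} | (C \subset P) &&
     [forall x in C, forall y in C, (x <= y)%O || (y <= x)%O]].

Definition cohen_macaulay_poset (k : fieldType) (disp : Order.disp_t)
    (T : finPOrderType disp) (P : {set T}) : Prop :=
  cohen_macaulay_complex k (order_complex P).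

(* Main.v *)
Require Import Defs.
From mathcomp Require Import all_boot all_order all_algebra.
From mathcomp Require Import zify.
From Stdlib Require Import Classical IndefiniteDescription.

(** Write e(a) = deg x(a) and call the lattice d-acyclic when every lower open
    interval (0,t), t <> 0, has no reduced homology in degree p - 1 unless
    e(t) = p + d.  Both sides of the theorem are
    equivalent to d-acyclicity for some d.

    Algebra.  An ideal I has a linear resolution iff its Koszul homology in
    homological degree p is concentrated in degree p + d: passing to a syzygy
    module shifts Koszul homology by one since free modules are Koszul-acyclic.
    For a monomial ideal the Koszul homology in multidegree m is the reduced
    homology of the complex of all G with x^(m - G) in I.  For M(L) this complex
    is a cone or empty unless m = x(t) for some t <> 0; for m = x(t) it is
    homotopy equivalent to (0,t), by a crosscut argument.

    Topology.  Given d-acyclicity, (ii) holds because a minimal x <= b lying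
    above atoms of two kinds (below a, or not below a) has a disconnected (0,x),
    which forces e(x) = d + 1.  Given (ii), the intervals (a,b) with a <> 0
    behave like those of a convex geometry, so that joining a complex with (a,b)
    shifts its range of vanishing by e(b) - e(a) - 1; this gives the vanishing
    for the links of all chains.  Conversely, (0,b) is the link of a maximal
    chain above b, and the disconnectedness argument shows that all atoms have
    the same degree. *)

Set Implicit Arguments.
Unset Strict Implicit.
Unset Printing Implicit Defensive.

Import Order.TTheory GRing.Theory.

(** * Weighted boundary operators *)

Section Koszul.
Local Open Scope ring_scope.
Variables (V : finType) (R : comNzRingType).
Implicit Types (G H : {set V}) (u v : V).

(** Homology never appears as a group, only as the statement that every cycle of a given size
    bounds. The single operator [kosz] serves both sides: weights 1 over [k] give the reduced
    simplicial boundary, weights ['X_v] give the Koszul differential, and fixing a multidegree turns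
    the second into the first. Homotopy equivalences become removals of faces paired off by toggling
    one vertex, so explicit chains do the work of exact sequences. Koszul homology enters because
    [graded_betti] allows a different resolution for every pair (i, j): it depends on the ideal
    alone, so the information from all these resolutions can be combined in it. Conversely, one
    resolution has to be produced, syzygy module after syzygy module; what survives each step is the
    concentration of Koszul homology on one line. The constant d is the common degree of the atoms:
    (0,a) is empty for an atom a, and the complex whose only face is empty has homology in degree
    -1, so p = 0 and e(a) = d. *)

Definition osgn v G : R :=
  (-1) ^+ #|[set w in G | (enum_rank w < enum_rank v)%N]|.

Lemma osgn_sqr v G : osgn v G * osgn v G = 1.
Proof. by rewrite -expr2 sqrr_sign. Qed.

Lemma osgnU1 u v G : v \notin G ->
  osgn u (v |: G) = osgn u G * (-1) ^+ (enum_rank v < enum_rank u)%N.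
Proof.
move=> vG; rewrite /osgn -exprD; congr (_ ^+ _).
case: ltnP => vu.
  rewrite addn1 (_ : [set w in _ | _] =
    v |: [set w in G | (enum_rank w < enum_rank u)%N]).
    by rewrite cardsU1 inE (negPf vG).
  by apply/setP=> w; rewrite !inE andb_orl; case: eqP => [->|//]; rewrite vu.
rewrite addn0; apply: eq_card => w; rewrite !inE andb_orl.
by case: eqP => [->|//]; rewrite ltnNge vu.
Qed.

Lemma sign_ranks u v : u != v ->
  (-1) ^+ (enum_rank v < enum_rank u)%N = - (-1) ^+ (enum_rank u < enum_rank v)%N :> R.
Proof.
move=> uv; have : enum_rank u != enum_rank v :> nat.
  by apply: contraNneq uv => /val_inj /enum_rank_inj ->.
by rewrite neq_ltn => /orP[] h; rewrite h ltnNge (ltnW h) ?expr0 ?expr1 ?opprK.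
Qed.

Lemma osgn_swap u v G : u != v -> u \notin G -> v \notin G ->
  osgn u (v |: G) * osgn v (u |: G) = - (osgn u G * osgn v G).
Proof.
move=> uv uG vG; rewrite !osgnU1 // mulrACA (sign_ranks uv).
by rewrite mulNr -expr2 sqrr_sign mulrN1.
Qed.

Lemma osgn_anti u v G : u != v -> u \notin G -> v \notin G ->
  osgn v G * osgn u (v |: G) = - (osgn u G * osgn v (u |: G)).
Proof.
move=> uv uG vG; rewrite !osgnU1 // !mulrA (mulrC (osgn v G)) (sign_ranks uv).
by rewrite mulrN.
Qed.

Variables (M : lmodType R) (x : V -> R).
Implicit Types c : {set V} -> M.

Definition kosz c G : M :=
  \sum_(v | v \notin G) (osgn v G * x v) *: c (v |: G).

Definition cone v c G : M :=
  if v \in G then osgn v (G :\ v) *: c (G :\ v) else 0.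

Lemma eq_kosz c c' : c =1 c' -> kosz c =1 kosz c'.
Proof. by move=> e G; apply: eq_bigr => v _; rewrite e. Qed.

Lemma koszD c c' G : kosz (fun H => c H + c' H) G = kosz c G + kosz c' G.
Proof. by rewrite -big_split /=; apply: eq_bigr => v _; rewrite scalerDr. Qed.

Lemma koszN c G : kosz (fun H => - c H) G = - kosz c G.
Proof. by rewrite -sumrN; apply: eq_bigr => v _; rewrite scalerN. Qed.

Lemma koszB c c' G : kosz (fun H => c H - c' H) G = kosz c G - kosz c' G.
Proof. by rewrite koszD koszN. Qed.

Lemma kosz0 c : c =1 (fun=> 0) -> kosz c =1 (fun=> 0).
Proof. by move=> e G; apply: big1 => v _; rewrite e scaler0. Qed.

Lemma koszK c G : kosz (kosz c) G = 0.
Proof.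
pose f v u := (osgn v G * osgn u (v |: G) * (x v * x u)) *: c (u |: (v |: G)).
have fN u v : u != v -> u \notin G -> v \notin G -> f u v = - f v u.
  move=> uv uG vG; rewrite /f -scaleNr setUCA (mulrC (x v)); congr (_ *: _).
  by rewrite -mulNr osgn_anti 1?eq_sym.
pose r u v := (enum_rank u < enum_rank v)%N.
have -> : kosz (kosz c) G =
  \sum_(v | v \notin G) \sum_(u | (u \notin G) && (u != v)) f v u.
  apply: eq_bigr => v vG; rewrite scaler_sumr; apply: eq_big => [u|u uvG].
    by rewrite !inE negb_or andbC.
  by rewrite scalerA mulrACA.
(* The double sum is split by which of u and v comes first in the enumeration; exchanging the sums
   in one half pairs each term with its negative by [fN]. *)
pose s (P : rel V) := \sum_(v | v \notin G) \sum_(u | (u \notin G) && P v u) f v u.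
transitivity (s r + s (fun v u => r u v)); last first.
  rewrite /s [X in _ + X](exchange_big_dep (fun u => u \notin G)) /=; last first.
    by move=> v u _ /andP[].
  rewrite -big_split big1 //= => v vG; rewrite [X in _ + X](eq_bigl (fun u => (u \notin G) && r v u)); last first.
    by move=> u; rewrite vG.
  rewrite -big_split big1 //= => u /andP[uG]; rewrite /r => vu.
  rewrite (fN v u) ?addNr //; by apply: contraTneq vu => ->; rewrite ltnn.
rewrite /s -big_split; apply: eq_bigr => v vG /=.
rewrite (bigID (r v)) /=; congr (_ + _); apply: eq_bigl => u; rewrite -andbA /r.
  congr (_ && _); apply/andP/idP => [[]//|vu]; split=> //.
  by apply: contraTneq vu => ->; rewrite ltnn.
congr (_ && _); rewrite -leqNgt [RHS]ltn_neqAle; congr (~~ _ && _).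
by apply/eqP/eqP => [->//|/val_inj /enum_rank_inj].
Qed.

(** [cone v] is a null-homotopy of multiplication by the weight of v. With weight 1 this is the
    acyclicity of cones. *)
Lemma kosz_cone v c G : kosz (cone v c) G + cone v (kosz c) G = x v *: c G.
Proof.
rewrite /kosz {2}/cone; case: ifPn => [vG|vG]; last first.
  rewrite addr0 (bigD1 v) //= big1 ?addr0 => [|u /andP[uG uv]]; last first.
    by rewrite /cone !inE (negPf vG) eq_sym (negPf uv) scaler0.
  by rewrite /cone setU11 setU1K // scalerA mulrAC osgn_sqr mul1r.
set H := G :\ v; have vH : v \notin H by rewrite !inE eqxx.
have GE : G = v |: H by rewrite setD1K.
rewrite [X in _ + _ *: X](bigD1 v) //= scalerDr addrCA scalerA mulrA osgn_sqr mul1r -GE.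
rewrite -[RHS]addr0; congr (_ + _).
rewrite scaler_sumr [X in _ + X](eq_bigl (fun u => u \notin G)); last first.
  by move=> u; rewrite !inE negb_and negbK; case: eqP => [->|//]; rewrite ?vG ?andbT ?andbF.
rewrite -big_split big1 //= => u uG.
have uv : u != v by apply: contraNneq uG => ->.
have uH : u \notin H by rewrite !inE (negPf uG) andbF.
rewrite /cone !inE vG orbT.
have -> : (u |: G) :\ v = u |: H.
  by apply/setP=> w; rewrite !inE; case: (w =P v) => [->|//]; rewrite eq_sym (negPf uv).
rewrite !scalerA -scalerDl mulrAC GE osgn_swap // mulrA.
by rewrite mulNr (mulrC (osgn v H)) addNr scale0r.
Qed.

End Koszul.

(** * Removing faces without changing homology *)

Section Acyclicity.
Local Open Scope ring_scope.
Variables (k : fieldType) (V : finType).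
Implicit Types (K : {set {set V}}) (G H : {set V}) (u v : V) (p : nat).
Implicit Types c : {set V} -> k^o.

Notation d := (@kosz V k k^o (fun=> 1)).
Notation cone := (@cone V k k^o).
Notation osgn := (@osgn V k).

Let eq_d c c' (e : c =1 c') G : d c G = d c' G := eq_kosz (fun=> 1) e G.

Definition chain K p c := forall G, c G != 0 -> (G \in K) && (#|G| == p).

Lemma boundaryE (c : {ffun {set V} -> k}) G : boundary c G = d c G.
Proof. by rewrite ffunE; apply: eq_bigr => v _; rewrite mulr1. Qed.

(** Passes from finite functions to plain ones, so that chains can be written as lambda terms and
    compared pointwise. *)
Lemma vanishesP K p : reduced_homology_vanishes k K p <->
  (forall z, chain K p z -> d z =1 (fun=> 0) ->
     exists2 c, chain K p.+1 c & d c =1 z).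
Proof.
split=> [vK z zK z0|vK z zK z0].
  have [||c [cK cz]] := vK [ffun G => z G].
  - by move=> G; rewrite ffunE; apply: zK.
  - by apply/ffunP=> G; rewrite boundaryE ffunE -(z0 G); apply: eq_d => H; rewrite ffunE.
  exists c => // G; rewrite -boundaryE cz ffunE //.
have [||c cK cz] := vK z.
- exact: zK.
- by move=> G; rewrite -boundaryE z0 ffunE.
exists [ffun G => c G]; split=> [G|]; first by rewrite ffunE; apply: cK.
by apply/ffunP=> G; rewrite boundaryE -cz; apply: eq_d => H; rewrite ffunE.
Qed.

Lemma vanishes_size K p :
  (forall G, G \in K -> #|G| != p) -> reduced_homology_vanishes k K p.
Proof.
move=> sz; apply/vanishesP => z zK _; exists (fun=> 0) => [G|G]; first by rewrite eqxx.
rewrite kosz0 //; apply/esym/eqP/contraT => /zK /andP[/sz]; by case: eqP.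
Qed.

Definition dclosed K := forall G H, G \in K -> H \subset G -> H \in K.

Lemma kosz_neq0 c G : d c G != 0 -> exists2 v, v \notin G & c (v |: G) != 0.
Proof.
move=> h; have [/existsP[v /andP[]]|] := boolP [exists v, (v \notin G) && (c (v |: G) != 0)].
  by exists v.
rewrite negb_exists => /forallP h0; case/negP: h; apply/eqP/big1 => v vG.
by have:= h0 v; rewrite vG /= negbK => /eqP->; rewrite scaler0.
Qed.

Lemma chain_kosz K p c : dclosed K -> chain K p.+1 c -> chain K p (d c).
Proof.
move=> dK cK G /kosz_neq0[v vG /cK /andP[vGK]].
by rewrite cardsU1 vG eqSS (dK _ _ vGK) ?subsetUr.
Qed.

Lemma chainB K p c c' : chain K p c -> chain K p c' -> chain K p (fun G => c G - c' G).
Proof.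
move=> cK cK' G; have [->|/cK//] := eqVneq (c G) 0.
by rewrite sub0r oppr_eq0 => /cK'.
Qed.

Lemma chainD K p c c' : chain K p c -> chain K p c' -> chain K p (fun G => c G + c' G).
Proof.
move=> cK cK' G; have [->|/cK//] := eqVneq (c G) 0.
by rewrite add0r => /cK'.
Qed.

Lemma chain_sub K K' p c : K \subset K' -> chain K p c -> chain K' p c.
Proof. by move=> sK cK G /cK/andP[/(subsetP sK)->]. Qed.

Lemma chain_cone K p v c :
  (forall G, c G != 0 -> (v |: G \in K) && (#|G| == p)) -> chain K p.+1 (cone v c).
Proof.
move=> h G; rewrite /cone; case: ifP => [vG|]; last by rewrite eqxx.
rewrite scaler_eq0 negb_or => /andP[_ /h]; rewrite setD1K // => /andP[-> /=].
by rewrite (cardsD1 v G) vG.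
Qed.

Lemma koszcone v c G : d (cone v c) G = c G - cone v (d c) G.
Proof. by rewrite -[c G]scale1r -(kosz_cone (fun=> 1) v) addrK. Qed.

Section Toggle.
Variables (K K' : {set {set V}}) (v : V).
Hypotheses (dK : dclosed K) (dK' : dclosed K') (sK : K' \subset K).
Hypothesis toggle : forall G, G \in K -> G \notin K' ->
  [&& v |: G \in K, v |: G \notin K' & G :\ v \notin K'].

Let res c G := if G \in K' then 0 else c G.

Lemma res_neq0 p c G : chain K p c -> res c G != 0 ->
  [/\ G \in K, G \notin K' & #|G| == p].
Proof.
by move=> cK; rewrite /res; case: ifP => [|_ /cK/andP[]//]; rewrite eqxx.
Qed.

Lemma chain_cone_res p c : chain K p c -> chain K p.+1 (cone v (res c)).
Proof.
move=> cK; apply: chain_cone => G /(res_neq0 cK)[GK GK' ->].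
by have /and3P[->] := toggle GK GK'.
Qed.

(* [c - d (cone v (res c)) = (c - res c) + cone v (d (res c))], and the second
   summand cannot leave [K'] because [d (res c)] vanishes outside [K']. *)
Lemma chain_push p c : chain K p c -> (forall G, G \notin K' -> d c G = 0) ->
  chain K' p (fun G => c G - d (cone v (res c)) G).
Proof.
move=> cK c0 G nz.
have := chainB cK (chain_kosz dK (chain_cone_res cK)) nz => /andP[GK ->].
rewrite andbT; apply: contraNT nz => GK'.
rewrite koszcone {1}/res (negPf GK') opprB addrC subrK.
have /and3P[_ _ GvK'] := toggle GK GK'.
rewrite /cone; case: ifP => // vG; rewrite scaler_eq0; apply/orP; right.
rewrite -(c0 _ GvK'); apply/eqP/eq_bigr => u uG; congr (_ *: _).
by rewrite /res ifN //; apply: contra GvK' => /dK'; apply; apply: subsetUr.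
Qed.

(** The faces outside [K'] are matched by inserting and deleting v, so the relative complex of [K]
    modulo [K'] has no homology. [res c] is the relative part of c, and subtracting the boundary of
    its cone pushes c into [K']. *)
Lemma vanishes_toggle p :
  reduced_homology_vanishes k K p <-> reduced_homology_vanishes k K' p.
Proof.
split=> /vanishesP vK; apply/vanishesP => z zK z0.
  have [|c cK cz] := vK z _ z0; first exact: chain_sub zK.
  exists (fun G => c G - d (cone v (res c)) G).
    apply: chain_push => // G GK'; rewrite cz; apply/eqP/contraT => /zK.
    by rewrite (negPf GK').
  by move=> G; rewrite koszB cz koszK subr0.
have [||c cK cz] := vK _ (chain_push zK _).
- by move=> G _; apply: z0.
- by move=> G; rewrite koszB z0 koszK subr0.
exists (fun G => c G + cone v (res z) G).
  by apply: chainD; [apply: chain_sub cK | apply: chain_cone_res].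
by move=> G; rewrite koszD cz subrK.
Qed.

End Toggle.

(** In a cone with apex v all faces are matched, down to the complex without any face, not even the
    empty one. *)
Lemma vanishes_apex K v p : dclosed K -> (forall G, G \in K -> v |: G \in K) ->
  reduced_homology_vanishes k K p.
Proof.
move=> dK vK; apply/(@vanishes_toggle K set0 v) => //.
- by move=> G H; rewrite inE.
- exact: sub0set.
- by move=> G /vK GK _; rewrite GK !inE.
by apply: vanishes_size => G; rewrite inE.
Qed.

(** Mayer-Vietoris for [K] as the union of the deletion of h and the cone over its link, on chains:
    a cycle is [zD] plus [cone h y], the cycle y of the link bounds some w, and adding the boundary
    of [cone h w] moves the cycle into the deletion. *)
Lemma vanishes_del K h p : dclosed K ->
  reduced_homology_vanishes k [set G in K | h \notin G] p ->
  (forall q, p = q.+1 -> reduced_homology_vanishes k (link K [set h]) q) ->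
  reduced_homology_vanishes k K p.
Proof.
move=> dK /vanishesP vD vL; apply/vanishesP => z zK z0.
set D := [set G in K | _] in vD.
have DK : D \subset K by apply/subsetP => G; rewrite inE => /andP[].
(* In size 0 the only possible face is the empty one, which already lies in the deletion. *)
case: p => [|p] in vD vL zK *.
  have [|c cD cz] := vD z _ z0; last by exists c => //; apply: chain_sub cD.
  move=> G /zK/andP[GK]; rewrite inE GK cards_eq0 => /eqP->.
  by rewrite inE eqxx.
have {vL} /vanishesP vL := vL _ erefl.
pose y G : k^o := if h \in G then 0 else osgn h G *: z (h |: G).
pose zD G : k^o := if h \in G then 0 else z G.
have zE G : z G = zD G + cone h y G.
  rewrite /zD /cone; case: ifP => [hG|_]; last by rewrite addr0.
  by rewrite /y !inE eqxx setD1K // scalerA osgn_sqr scale1r add0r.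
(* For G without h, the value of [d z] at [h |: G] is, up to sign, that of [d y] at G: the part [zD]
   has no face containing h. *)
have dy G : d y G = 0.
  have [hG|hG] := boolP (h \in G).
    by apply: big1 => u _; rewrite /y inE hG orbT scaler0.
  have := z0 (h |: G); rewrite (eq_d zE) koszD {1}/kosz big1 ?add0r; last first.
    by move=> u _; rewrite /zD !inE eqxx orbT scaler0.
  rewrite koszcone /y setU11 sub0r /cone setU11 setU1K // => /eqP.
  by rewrite oppr_eq0 scaler_eq0 signr_eq0 => /eqP.
have [||w wL wy] := vL y.
- move=> G; rewrite /y; case: ifPn => [|hG]; first by rewrite eqxx.
  rewrite scaler_eq0 negb_or => /andP[_ /zK]; rewrite inE disjoints1 hG.
  by rewrite cardsU1 hG eqSS => /andP[->].
- exact: dy.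
have cw : chain K p.+2 (cone h w).
  by apply: chain_cone => G /wL /andP[]; rewrite inE => /andP[_ ->].
have zw G : z G + d (cone h w) G = zD G + w G.
  have -> : d (cone h w) G = w G - cone h y G by rewrite koszcone /cone wy.
  by rewrite zE addrACA subrr addr0.
have [||c cD cz] := vD (fun G => zD G + w G).
- apply: chainD => G; rewrite /zD ?inE.
    by case: ifPn => [|hG]; [rewrite eqxx | move=> /zK/andP[->]; rewrite ?hG].
  move=> /wL/andP[]; rewrite inE disjoints1 => /andP[-> hGK] ->.
  by rewrite (dK _ _ hGK) ?subsetUr.
- by move=> G; rewrite -(eq_d zw) koszD z0 koszK addr0.
exists (fun G => c G - cone h w G).
  by apply: chainB => //; apply: chain_sub cD.
by move=> G; rewrite koszB cz -zw addrK.
Qed.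

End Acyclicity.

(** * Transport of homology along order-preserving injections *)

Section Transport.
Local Open Scope ring_scope.
Variables (k : fieldType) (V W : finType) (f : V -> W).
Hypothesis inj_f : injective f.
Hypothesis rank_f : forall u v,
  (enum_rank (f u) < enum_rank (f v))%N = (enum_rank u < enum_rank v)%N.
Implicit Types (K : {set {set V}}) (G : {set V}).

Notation dV := (@kosz V k k^o (fun=> 1)).
Notation dW := (@kosz W k k^o (fun=> 1)).

Lemma osgn_imset v G : osgn k (f v) (f @: G) = osgn k v G.
Proof.
rewrite /osgn; congr (_ ^+ _); rewrite -(card_imset _ inj_f); apply: eq_card => w.
rewrite inE; apply/andP/imsetP => [[/imsetP[u uG ->]]|[u]].
  by rewrite rank_f => uv; exists u; rewrite // inE uG.
by rewrite inE => /andP[uG uv] ->; rewrite rank_f imset_f.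
Qed.

Definition pull (c : {set W} -> k^o) G : k^o := c (f @: G).
Definition push (c : {set V} -> k^o) (H : {set W}) : k^o :=
  if H \subset f @: setT then c (f @^-1: H) else 0.

Lemma preim_imset G : f @^-1: (f @: G) = G.
Proof. by apply/setP=> v; rewrite inE mem_imset. Qed.

Lemma imset_preim (H : {set W}) : H \subset f @: setT -> f @: (f @^-1: H) = H.
Proof.
move=> /subsetP sH; apply/setP=> w; apply/imsetP/idP => [[v]|wH].
  by rewrite inE => vH ->.
by have /imsetP[v _ wE] := sH _ wH; exists v; rewrite // inE -wE.
Qed.

Lemma imset_codom G : f @: G \subset f @: setT.
Proof. by apply: imsetS; apply: subsetT. Qed.

Lemma pull_push (c : {set V} -> k^o) : pull (push c) =1 c.
Proof. by move=> G; rewrite /pull /push imset_codom preim_imset. Qed.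

Lemma kosz_pull (c : {set W} -> k^o) G : (forall H : {set W}, c H != 0 -> H \subset f @: setT) ->
  dW c (f @: G) = dV (pull c) G.
Proof.
move=> sc; rewrite /kosz (bigID (mem (f @: ~: G))) /= [X in _ + X]big1 ?addr0.
  rewrite (eq_bigl (mem (f @: ~: G))) => [|w]; last first.
    apply: andb_idl => /imsetP[v]; rewrite inE => vG ->.
    by rewrite mem_imset.
  rewrite big_imset /=; last by move=> u v _ _ /inj_f.
  apply: eq_big => [v|v]; rewrite inE // => vG.
  by rewrite osgn_imset /pull imsetU1.
move=> w /andP[wG wnG]; have [->|/sc] := eqVneq (c (w |: f @: G)) 0.
  by rewrite scaler0.
rewrite subUset sub1set => /andP[/imsetP[v _ wE] _].
case/negP: wnG; rewrite wE mem_imset // inE; apply: contra wG => vG.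
by rewrite wE mem_imset.
Qed.

Lemma kosz_push (c : {set V} -> k^o) : dW (push c) =1 push (dV c).
Proof.
have sp (H : {set W}) : push c H != 0 -> H \subset f @: setT.
  by rewrite /push; case: ifP => //; rewrite eqxx.
move=> H; rewrite {2}/push; case: ifPn => [sH|nH].
  rewrite -{1}(imset_preim sH) kosz_pull //.
  by apply: eq_kosz; apply: pull_push.
apply/eqP/contraT => /kosz_neq0[w _ /sp]; rewrite subUset => /andP[_].
by rewrite (negPf nH).
Qed.

(** Boundary signs come from the enumeration order, so f has to respect it; then no sign changes
    occur. Both injections into a sum type qualify. *)
Lemma vanishes_imset K p :
  reduced_homology_vanishes k [set f @: G | G : {set V} in K] p <->
  reduced_homology_vanishes k K p.
Proof.
have chp q (c : {set V} -> k^o) : chain K q c -> chain [set f @: G | G : {set V} in K] q (push c).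
  move=> cK H; rewrite /push; case: ifPn => [sH /cK/andP[HK /eqP<-]|_]; last by rewrite eqxx.
  by rewrite -{1 2}(imset_preim sH) imset_f //= card_imset.
have chl q (c : {set W} -> k^o) : chain [set f @: G | G : {set V} in K] q c -> chain K q (pull c).
  move=> cK G /cK; rewrite card_imset // => /andP[/imsetP[H HK e] ->].
  by rewrite (imset_inj inj_f e) HK.
have sc q (c : {set W} -> k^o) : chain [set f @: G | G : {set V} in K] q c ->
    forall H : {set W}, c H != 0 -> H \subset f @: setT.
  by move=> cK H /cK /andP[/imsetP[G _ ->] _]; apply: imset_codom.
split=> /vanishesP vK; apply/vanishesP => z zK z0.
  have [||c cK cz] := vK (push z); first exact: chp.
    by move=> H; rewrite kosz_push /push z0 if_same.
  exists (pull c); first exact: chl.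
  by move=> G; rewrite -kosz_pull ?cz; [apply: pull_push | apply: sc cK].
have [||c cK cz] := vK (pull z); first exact: chl.
  by move=> G; rewrite -kosz_pull ?z0; [ | apply: sc zK].
exists (push c); first exact: chp.
move=> H; rewrite kosz_push /push; case: ifPn => [sH|nH].
  by rewrite cz /pull imset_preim.
by apply/esym/eqP/contraT => /(sc _ _ zK); rewrite (negPf nH).
Qed.

End Transport.

Section SumRank.
Local Open Scope ring_scope.
Variables V W : finType.

Lemma enum_rankE (T : finType) (x : T) : enum_rank x = index x (enum T) :> nat.
Proof.
by rewrite -{2}(enum_rankK x) (enum_val_nth x) index_uniq ?enum_uniq // -cardE.
Qed.

Lemma enum_sum : enum {: V + W} = map inl (enum V) ++ map inr (enum W).
Proof. by rewrite !enumT {1}unlock. Qed.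

Lemma enum_rank_inl (u v : V) :
  (enum_rank (inl u : V + W) < enum_rank (inl v : V + W))%N = (enum_rank u < enum_rank v)%N.
Proof.
by rewrite !enum_rankE enum_sum !index_cat !map_f ?mem_enum // !index_map //; apply: inl_inj.
Qed.

Lemma enum_rank_inr (u v : W) :
  (enum_rank (inr u : V + W) < enum_rank (inr v : V + W))%N = (enum_rank u < enum_rank v)%N.
Proof.
have ni (x : W) : inr x \in map (@inl V W) (enum V) = false.
  by apply/negP => /mapP[].
by rewrite !enum_rankE enum_sum !index_cat !ni !index_map ?ltn_add2l //; apply: inr_inj.
Qed.

End SumRank.

(** * Chains in posets *)

Section Poset.
Local Open Scope order_scope.
Variables (disp : Order.disp_t) (T : finPOrderType disp).
Implicit Types (x y : T) (P C : {set T}) (K : {set {set T}}).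

Lemma ex_minimal (P : pred T) x : P x ->
  exists m, [/\ P m, m <= x & forall y, P y -> y <= m -> y = m].
Proof.
move: {2}#|_|.+1 (ltnSn #|[set y | y <= x]|) => n; elim: n x => // n IH x xn Px.
have [/existsP[y /andP[Py yx]]|] := boolP [exists y, P y && (y < x)].
  have [|m [Pm my mm]] := IH y _ Py; last by exists m; rewrite (le_trans my) ?ltW.
  rewrite ltnS in xn; apply: leq_trans xn; apply: proper_card; apply/properP; split.
    by apply/subsetP=> z; rewrite !inE => /le_trans; apply; apply: ltW.
  by exists x; rewrite inE // lt_geF.
rewrite negb_exists => /forallP h; exists x; split=> // y Py yx.
by apply/eqP; have := h y; rewrite Py lt_neqAle yx andbT /= negbK.
Qed.

Lemma ex_maximal (P : pred T) x : P x ->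
  exists m, [/\ P m, x <= m & forall y, P y -> m <= y -> y = m].
Proof.
move: {2}#|_|.+1 (ltnSn #|[set y | x <= y]|) => n; elim: n x => // n IH x xn Px.
have [/existsP[y /andP[Py yx]]|] := boolP [exists y, P y && (x < y)].
  have [|m [Pm my mm]] := IH y _ Py; last by exists m; rewrite (le_trans _ my) ?ltW.
  rewrite ltnS in xn; apply: leq_trans xn; apply: proper_card; apply/properP; split.
    by apply/subsetP=> z; rewrite !inE; apply: le_trans; apply: ltW.
  by exists x; rewrite inE // lt_geF.
rewrite negb_exists => /forallP h; exists x; split=> // y Py yx.
by apply/esym/eqP; have := h y; rewrite Py lt_neqAle yx andbT /= negbK.
Qed.

Lemma order_complexP P C : reflect
  (C \subset P /\ {in C &, forall x y, x <= y \/ y <= x}) (C \in order_complex P).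
Proof.
rewrite inE; apply: (iffP andP) => -[sC h]; split=> //.
  by move=> x y xC yC; apply/orP; apply: (implyP (forallP (implyP (forallP h x) xC) y)).
apply/forallP => x; apply/implyP => xC; apply/forallP => y; apply/implyP => yC.
by apply/orP; apply: h.
Qed.

Lemma order_complex_dclosed P : dclosed (order_complex P).
Proof.
move=> C D /order_complexP[sC h] sD; apply/order_complexP; split.
  exact: subset_trans sC.
by move=> x y /(subsetP sD) xC /(subsetP sD) yC; apply: h.
Qed.

Lemma order_complexU1 P C x : C \in order_complex P -> x \in P ->
  {in C, forall y, x <= y \/ y <= x} -> x |: C \in order_complex P.
Proof.
move=> /order_complexP[sC h] xP hx; apply/order_complexP; split.
  by rewrite subUset sub1set xP.
move=> y z /setU1P[->|yC] /setU1P[->|zC]; first by left.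
- exact: hx.
- by case: (hx _ yC); [right|left].
exact: h.
Qed.

Lemma order_complex0 P : set0 \in order_complex P.
Proof. by apply/order_complexP; split=> [|x y]; rewrite ?sub0set ?inE. Qed.

Variable k : fieldType.

(** S is a union of connected components. If the 0-cycle [x1] - [x2] were the boundary of c, the
    part [c1] of c inside S would have boundary [x1], whose augmentation is 1, contradicting that
    the boundary squares to zero. *)
Lemma disconnected P (S : pred T) x1 x2 : x1 \in P -> x2 \in P -> S x1 -> ~~ S x2 ->
  {in P &, forall x y, x <= y -> S x = S y} ->
  ~ reduced_homology_vanishes k (order_complex P) 1.
Proof.
move=> x1P x2P S1 S2 PS /vanishesP vP.
pose e0 (G : {set T}) : k^o := (G == set0)%:R%R.
pose z (G : {set T}) : k^o := (cone x1 e0 G - cone x2 e0 G)%R.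
have e0_neq0 G : e0 G != 0%R -> G = set0.
  by rewrite /e0; case: (G =P set0) => // _; rewrite eqxx.
have de0 G : kosz (fun=> 1%R) e0 G = 0%R.
  apply/eqP/contraT => /kosz_neq0[v _ /e0_neq0 /setP /(_ v)].
  by rewrite !inE eqxx.
have dce x G : kosz (fun=> 1%R) (cone x e0) G = e0 G.
  by rewrite koszcone /cone de0 scaler0 if_same subr0.
have cK x : x \in P -> chain (order_complex P) 1 (cone x e0).
  move=> xP; apply: chain_cone => G /e0_neq0->; rewrite cards0 eqxx andbT.
  by apply: order_complexU1 => //; [apply: order_complex0 | move=> y; rewrite inE].
have [||c cP cz] := vP z.
- by apply: chainB; apply: cK.
- by move=> G; rewrite koszB !dce subrr.
pose c1 (G : {set T}) : k^o := if [forall x in G, S x] then c G else 0%R.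
have dc1 x : kosz (fun=> 1%R) c1 [set x] = if S x then z [set x] else 0%R.
  case: ifPn => Sx.
    rewrite -cz; apply: eq_bigr => v vx; congr (_ *: _)%R; rewrite /c1.
    case: ifPn => // /forallP nS; apply/esym/eqP/contraT => /cP/andP[/order_complexP[sC h] _].
    have xP : x \in P by apply: (subsetP sC); rewrite !inE eqxx orbT.
    have vP' : v \in P by apply: (subsetP sC); rewrite !inE eqxx.
    have Svx : S v = S x.
      have [||le|le] := h v x; rewrite ?inE ?eqxx ?orbT //; last apply/esym; exact: PS.
    case: nS => y; apply/implyP; rewrite !inE => /orP[] /eqP-> //; by rewrite Svx.
  apply: big1 => v _; rewrite /c1 ifN ?scaler0 //; apply/forallPn; exists x.
  by rewrite !inE eqxx orbT.
have os v : osgn k v set0 = 1%R.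
  by rewrite /osgn eq_card0 // => w; rewrite !inE.
have zE x : z [set x] = ((x == x1)%:R - (x == x2)%:R)%R.
  have ce y : cone y e0 [set x] = (x == y)%:R%R.
    rewrite /cone inE eq_sym; case: eqP => [->|] //.
    by rewrite setDv os scale1r /e0 eqxx.
  by rewrite /z !ce.
have := koszK (fun=> 1%R) c1 set0; rewrite {1}/kosz (bigD1 x1) ?inE //= big1 ?addr0.
  rewrite setU0 dc1 S1 zE eqxx os mulr1 scale1r (_ : x1 == x2 = false) ?subr0.
    by apply/eqP; apply: oner_neq0.
  by apply: contraNF S2 => /eqP <-.
move=> x /andP[_ xx1]; rewrite setU0 dc1 zE (negPf xx1); case: ifP => Sx; last by rewrite scaler0.
have -> : x == x2 = false by apply: contraNF S2 => /eqP <-.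
by rewrite subrr scaler0.
Qed.

(* The join of [K] with the order complex of [P], provided that [K] avoids [P]. *)
Definition join_complex K P : {set {set T}} :=
  [set C | (C :\: P \in K) && (C :&: P \in order_complex P)].

(** Keeps the two factors apart: a vertex deleted from [P] must not reappear as a vertex of the
    factor [K]. *)
Definition avoids K P := forall G x, G \in K -> x \in G -> x \notin P.

Lemma in_join_complex K P C :
  (C \in join_complex K P) = (C :\: P \in K) && (C :&: P \in order_complex P).
Proof. by rewrite in_set. Qed.

Lemma join_complex_dclosed K P : dclosed K -> dclosed (join_complex K P).
Proof.
move=> dK C D; rewrite !in_join_complex => /andP[CK CP] sD; apply/andP; split.
  by apply: dK CK _; apply: setSD.
by apply: order_complex_dclosed CP _; apply: setSI.
Qed.

Lemma in_join_complexD1 K P x C : avoids K P -> x \in P ->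
  (C \in join_complex K (P :\ x)) = (C \in join_complex K P) && (x \notin C).
Proof.
move=> aK xP.
have DP : x \notin C -> C :\: (P :\ x) = C :\: P /\ C :&: (P :\ x) = C :&: P.
  move=> xC; split; apply/setP => y; rewrite !inE; case: eqP => // ->.
    by rewrite (negPf xC) !andbF.
  by rewrite (negPf xC).
have [xC|xC] := boolP (x \in C); rewrite ?andbT ?andbF.
    apply/negP; rewrite in_join_complex => /andP[CK _]; have := aK _ x CK.
    by rewrite !inE eqxx xC xP => /(_ isT).
  have [e1 e2] := DP xC; rewrite !in_join_complex e1 e2; congr (_ && _).
  apply/order_complexP/order_complexP => -[sC h]; split=> //.
    exact: subset_trans sC (subD1set _ _).
  by rewrite subsetD1 sC inE (negPf xC).
Qed.

End Poset.

(** * Contraction of a set of lattice elements along joins *)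

Section Contract.
Local Open Scope order_scope.
Variables (k : fieldType) (disp : Order.disp_t) (T : finTBLatticeType disp).
Implicit Types (x y : T) (P C : {set T}) (K : {set {set T}}).

(* [P] is contracted onto its elements above [u] along [x |-> x `|` u], removing
   the remaining elements one at a time from the top. *)
Lemma vanishes_contract K P u p : dclosed K -> avoids K P -> u \in P ->
  {in P, forall x, x `|` u \in P} ->
  reduced_homology_vanishes k (join_complex K P) p.
Proof.
move=> dK; move: {2}#|_|.+1 (ltnSn #|[set x in P | ~~ (u <= x)]|) => n.
elim: n P => // n IH P Pn aK uP Pu.
have [/existsP[x0 x0P]|] := boolP [exists x, (x \in P) && ~~ (u <= x)]; last first.
  rewrite negb_exists => /forallP h.
  have uP' x : x \in P -> u <= x by move=> xP; have := h x; rewrite xP negbK.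
  apply: (@vanishes_apex _ _ _ u); first exact: join_complex_dclosed.
  move=> C; rewrite in_join_complex => /andP[CK CP]; rewrite in_join_complex setDUl setIUl.
  have /setIidPl-> : [set u] \subset P by rewrite sub1set.
  have /eqP-> : [set u] :\: P == set0 by rewrite setD_eq0 sub1set.
  rewrite set0U CK /=; apply: order_complexU1 => // y; rewrite inE => /andP[_ /uP']; by left.
(* By maximality an element of [P] strictly above x lies above u. Hence whatever is comparable to x
   is comparable to x [|] u, which can be toggled in every chain through x. *)
have [x [/andP[xP ux] _ xmax]] := @ex_maximal _ _ (fun x => (x \in P) && ~~ (u <= x)) _ x0P.
have xuP := Pu _ xP.
have xux : x `|` u != x by apply: contraNneq ux => <-; apply: leUr.
have aK' : avoids K (P :\ x) by move=> G y GK yG; rewrite inE negb_and (aK _ _ GK yG) orbT.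
have vP : reduced_homology_vanishes k (join_complex K (P :\ x)) p.
  apply: IH => //.
  - rewrite ltnS in Pn; apply: leq_trans Pn; apply: proper_card; apply/properP; split.
      by apply/subsetP=> z; rewrite !inE -andbA => /andP[_].
    by exists x; rewrite !inE ?xP ?ux // eqxx.
  - by rewrite !inE uP andbT; apply: contraNneq ux => ->.
  move=> y; rewrite !inE => /andP[yx yP]; rewrite Pu // andbT.
  by apply: contraNneq ux => <-; apply: leUr.
have jx C := in_join_complexD1 C aK xP.
apply/(@vanishes_toggle _ _ (join_complex K P) (join_complex K (P :\ x)) (x `|` u)) => //.
- exact: join_complex_dclosed.
- exact: join_complex_dclosed.
- by apply/subsetP => C; rewrite jx => /andP[].
move=> C CP; rewrite !jx CP negb_and /= !negbK => xC; apply/and3P; split.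
- move: CP; rewrite !in_join_complex => /andP[CK CP].
  rewrite setDUl setIUl.
  have /setIidPl-> : [set x `|` u] \subset P by rewrite sub1set.
  have /eqP-> : [set x `|` u] :\: P == set0 by rewrite setD_eq0 sub1set.
  rewrite set0U CK /=.
  apply: (order_complexU1 CP xuP) => y yC.
  have xCP : x \in C :&: P by rewrite inE xC xP.
  have yP : y \in P by move: yC; rewrite inE => /andP[].
  have /order_complexP[_ /(_ x y xCP yC)[xy|yx]] := CP; last first.
    by right; apply: le_trans yx (leUl _ _).
  have [uy|uy] := boolP (u <= y); first by left; rewrite leUx xy.
  by rewrite (xmax y) ?yP //; right; apply: leUl.
- by rewrite negb_and !inE xC orbT orbT.
by rewrite negb_and !inE xC eq_sym xux /= orbT.
Qed.

End Contract.

(** * Meet-irreducible elements *)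

Section MeetIrreducibles.
Local Open Scope order_scope.
Variables (disp : Order.disp_t) (T : finTBLatticeType disp).
Implicit Types (a b x y u l : T).

Lemma coversP a b : reflect (a < b /\ forall c, a < c -> c <= b -> c = b) (covers b a).
Proof.
apply: (iffP andP) => -[ab h]; split=> //.
  move=> c ac cb; apply/eqP; have := forallP h c.
  by rewrite ac lt_neqAle cb andbT /= negbK.
apply/forallP => c; apply/negP => /andP[ac cb].
by have := h c ac (ltW cb) => e; rewrite e ltxx in cb.
Qed.

Lemma ex_cover a b : a < b -> exists2 u, covers u a & u <= b.
Proof.
move=> ab; have [|u [au ub um]] := @ex_minimal _ _ (fun x => a < x) b; first exact: ab.
by exists u => //; apply/coversP; split=> // c ac cu; apply: um.
Qed.

Lemma ex_atom x : x != \bot -> exists2 a, atom a & a <= x.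
Proof. by move=> x0; apply: ex_cover; rewrite lt0x. Qed.

Lemma atom_neq0 a : atom a -> a != \bot.
Proof. by move=> /coversP[+ _]; rewrite lt0x. Qed.

Lemma atom_le a x : atom a -> x != \bot -> x <= a -> x = a.
Proof. by move=> /coversP[_ h] x0; apply: h; rewrite lt0x. Qed.

(** Take l maximal above y but not above x. Every cover of l then lies above x, hence equals the
    join of l and x, so l has a single cover. That y is nonzero puts l in the proper part. *)
Lemma meet_irr_sep x y : y != \bot -> ~~ (x <= y) ->
  exists l, [/\ l \in meet_irr T, y <= l & ~~ (x <= l)].
Proof.
move=> y0 xy.
have [|l [/andP[yl xl] _ lm]] := @ex_maximal _ _ (fun z => (y <= z) && ~~ (x <= z)) y.
  by rewrite lexx.
exists l; split=> //.
have lx : l < l `|` x.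
  by rewrite lt_neqAle leUl andbT; apply: contraNneq xl => ->; apply: leUr.
have [u ul ux] := ex_cover lx.
have uE v : covers v l -> v = l `|` x.
  move=> /coversP[lv vm]; apply/esym/vm => //; rewrite leUx ltW //=.
  have [//|xv] := boolP (x <= v).
  have vl : v = l by apply: lm; rewrite ?xv ?(le_trans yl) ?ltW.
  by rewrite vl ltxx in lv.
rewrite !inE; apply/andP; split.
  apply/andP; split; first by apply: contraNneq y0 => l0; rewrite l0 lex0 in yl.
  by apply: contraNneq xl => ->; apply: lex1.
apply/cards1P; exists (l `|` x); apply/setP=> v; rewrite !inE.
by apply/idP/eqP => [/uE//|->]; rewrite -(uE _ ul).
Qed.

Definition mi_notabove a : {set T} := [set l in meet_irr T | ~~ (a <= l)].
Lemma in_mi_notabove a l : (l \in mi_notabove a) = (l \in meet_irr T) && ~~ (a <= l).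
Proof. by rewrite in_set. Qed.

(* The degree of x(a), see [total_degree_xmon]. *)
Definition ht a := #|mi_notabove a|.

(** In terms of monomials, x of a join is the least common multiple. *)
Lemma mi_notaboveU a b : mi_notabove (a `|` b) = mi_notabove a :|: mi_notabove b.
Proof. by apply/setP=> l; rewrite !inE leUx negb_and -andb_orr. Qed.

Lemma mi_notaboveS a b : a <= b -> mi_notabove a \subset mi_notabove b.
Proof. by move=> /join_idPl <-; rewrite mi_notaboveU subsetUr. Qed.

Lemma mi_notabove_le x y : y != \bot -> mi_notabove x \subset mi_notabove y -> x <= y.
Proof.
move=> y0 /subsetP s; have [//|/(meet_irr_sep y0) [l [lM yl xl]]] := boolP (x <= y).
by have := s l; rewrite !in_mi_notabove lM xl yl => /(_ isT).
Qed.

Lemma ht_le a b : a <= b -> (ht a <= ht b)%N.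
Proof. by move=> /mi_notaboveS /subset_leq_card. Qed.

Lemma ht_lt a b : a != \bot -> a < b -> (ht a < ht b)%N.
Proof.
move=> a0 ab; apply: proper_card; rewrite properE mi_notaboveS ?ltW //.
by apply/negP => /(mi_notabove_le a0); rewrite (lt_geF ab).
Qed.

Definition ival a b := [set x : T | a < x < b].

Lemma ival_bot_neq0 b x : x \in ival \bot b -> x != \bot.
Proof. by rewrite inE lt0x => /andP[]. Qed.

Lemma proper_part_ival : proper_part T = ival \bot \top.
Proof. by apply/setP=> x; rewrite !inE lt0x ltx1. Qed.

Lemma chain_top (P : {set T}) C : C \in order_complex P -> C != set0 ->
  exists2 a, a \in C & {in C, forall x, x <= a}.
Proof.
move=> /order_complexP[_ h] /set0Pn[x0 x0C].
have [m [mC _ mm]] := @ex_maximal _ _ (mem C) x0 x0C.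
exists m => // x xC; have [//|mx] := h x m xC mC.
by rewrite (mm x).
Qed.

Lemma chainD1_ival b C a : C \in order_complex (ival \bot b) -> a \in C ->
  {in C, forall x, x <= a} -> C :\ a \in order_complex (ival \bot a).
Proof.
move=> /order_complexP[sC h] aC am; apply/order_complexP; split.
  apply/subsetP=> x; rewrite !inE => /andP[xa xC].
  by have := subsetP sC x xC; rewrite inE => /andP[-> _]; rewrite lt_neqAle xa am.
by move=> x y; rewrite !inE => /andP[_ xC] /andP[_ yC]; apply: h.
Qed.

(** [ht] grows strictly along the chain and once more up to b, starting from an atom below its least
    element. This bounds the dimension of the order complex of a lower interval. *)
Lemma chain_ht b C : b != \bot -> C \in order_complex (ival \bot b) ->
  exists a, [/\ atom a, a <= b & (#|C| + ht a <= ht b)%N].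
Proof.
move: {2}#|C|.+1 (ltnSn #|C|) => n; elim: n b C => // n IH b C Cn b0 CP.
have [->|C0] := eqVneq C set0.
  by have [a aA ab] := ex_atom b0; exists a; rewrite cards0 ht_le.
have [c cC cm] := chain_top CP C0.
have cP : c \in ival \bot b by have /order_complexP[/subsetP sC _] := CP; apply: sC.
have c0 := ival_bot_neq0 cP.
move: Cn; rewrite (cardsD1 c) cC ltnS => Cn.
have [//|//||a [aA ac ha]] := IH c (C :\ c); first exact: chainD1_ival CP cC cm.
have cb : c < b by move: cP; rewrite inE => /andP[].
exists a; split=> //; first by rewrite (le_trans ac) ?ltW.
by rewrite -addnA add1n (leq_ltn_trans ha) ?ht_lt.
Qed.

End MeetIrreducibles.

Lemma setDIr0 (V : finType) (A B C : {set V}) : A :&: B = A :&: C -> A :\: B = A :\: C.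
Proof.
move=> /setP e; apply/setP=> x; have := e x; rewrite !inE.
by case: (x \in A); rewrite ?andbF ?andbT //= => ->.
Qed.

(** * Intervals in lattices whose covers raise the degree by one *)

Section Graded.
Local Open Scope order_scope.
Variables (k : fieldType) (disp : Order.disp_t) (T : finTBLatticeType disp).
Implicit Types (a b x y u l : T) (C F : {set T}) (K : {set {set T}}).

Notation rhv := (reduced_homology_vanishes k).

Hypothesis ht_cover : forall a b : T, covers b a -> a != \bot -> ht b = (ht a).+1.

Lemma mi_notabove_cover a u : a != \bot -> covers u a ->
  exists2 l, l \notin mi_notabove a & mi_notabove u = l |: mi_notabove a.
Proof.
move=> a0 ua; have s : mi_notabove a \subset mi_notabove u.
  by apply: mi_notaboveS; apply: ltW; case: (coversP _ _ ua).
have /cards1P[l lE] : #|mi_notabove u :\: mi_notabove a| == 1%N.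
  by rewrite cardsDS // -/(ht u) -/(ht a) (ht_cover ua) // subSnn.
exists l; first by have := set11 l; rewrite -lE inE => /andP[].
by rewrite -lE -{1}(setID (mi_notabove u) (mi_notabove a)) (setIidPr s) setUC.
Qed.

(** The counterpart of [chain_ht]: when all atoms have the same [ht], the two determine the
    dimension of (0,b). *)
Lemma saturated_chain a b : atom a -> a <= b ->
  exists2 C, C \in order_complex (ival \bot b) & #|C| = (ht b - ht a)%N.
Proof.
move: {2}(ht b).+1 (ltnSn (ht b)) => n; elim: n b => // n IH b bn aA ab.
have [<-|nab] := eqVneq a b; first by exists set0; rewrite ?order_complex0 // cards0 subnn.
have ltab : a < b by rewrite lt_neqAle nab.
have [|c [/andP[ac cb] _ cm]] := @ex_maximal _ _ (fun x => (a <= x) && (x < b)) a.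
  by rewrite lexx.
have c0 : c != \bot by apply: contraNneq (atom_neq0 aA) => c0; rewrite c0 lex0 in ac.
have bc : covers b c.
  apply/coversP; split=> // x cx xb; have [//|nxb] := eqVneq x b.
  have xc : x = c.
    by apply: cm; [rewrite (le_trans ac (ltW cx)) lt_neqAle nxb | apply: ltW].
  by rewrite xc ltxx in cx.
have hb := ht_cover bc c0.
have [|C CP sC] := IH c _ aA ac; first by rewrite -ltnS -hb.
have /order_complexP[sCi _] := CP.
have cC : c \notin C by apply/negP => /(subsetP sCi); rewrite inE ltxx andbF.
exists (c |: C); last by rewrite cardsU1 cC sC hb subSn ?ht_le.
apply: order_complexU1.
- apply/order_complexP; split; last by case/order_complexP: CP.
  apply/subsetP=> x /(subsetP sCi); rewrite !inE => /andP[-> xc].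
  exact: lt_trans cb.
- by rewrite inE lt0x c0.
by move=> y /(subsetP sCi); rewrite inE => /andP[_ /ltW]; right.
Qed.

(* The open interval contracts onto a cover [u] of [a], except for the at most
   one coatom [h] of the interval with [h `|` u = b]. *)
Lemma vanishes_join_ival K a b m p : dclosed K -> avoids K (ival a b) ->
  a != \bot -> a < b -> (forall q, (q < m)%N -> rhv K q) ->
  (p.+1 + ht a < m + ht b)%N -> rhv (join_complex K (ival a b)) p.
Proof.
move=> dK + a0 + vK; move: {2}(ht b).+1 (ltnSn (ht b)) => n.
elim: n b p => // n IH b p bn aK ab pm.
have [u ua ub] := ex_cover ab; have /coversP[au um] := ua.
have [uE|nub] := eqVneq u b.
  have -> : ival a b = set0.
    apply/setP=> x; rewrite !inE; apply/negP => /andP[ax xb].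
    have xu : x = u by apply: um; rewrite ?uE ?ltW.
    by rewrite xu uE ltxx in xb.
  have -> : join_complex K set0 = K.
    by apply/setP=> C; rewrite in_join_complex setD0 setI0 order_complex0 andbT.
  by apply: vK; move: pm (ht_cover ua a0); rewrite uE; clear; lia.
have ltub : u < b by rewrite lt_neqAle nub.
have uI : u \in ival a b by rewrite inE au.
have [l la lE] := mi_notabove_cover a0 ua.
have xuE x : a <= x -> mi_notabove (x `|` u) = l |: mi_notabove x.
  move=> ax; rewrite mi_notaboveU lE setUCA; congr (_ |: _).
  by apply/setUidPl/mi_notaboveS.
have neq0 x : a <= x -> x != \bot.
  by move=> ax; apply: contraNneq a0 => x0; rewrite x0 lex0 in ax.
have xuI x : x \in ival a b -> x `|` u != b -> x `|` u \in ival a b.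
  rewrite !inE => /andP[ax xb] xub; rewrite (lt_le_trans ax) ?leUl //=.
  by rewrite lt_neqAle xub leUx !ltW.
have [/existsP[h /andP[hI /eqP huE]]|] := boolP [exists h, (h \in ival a b) && (h `|` u == b)];
  last first.
  rewrite negb_exists => /forallP nh; apply: (@vanishes_contract _ _ _ _ _ u) => //.
  by move=> x xI; apply: xuI => //; have := nh x; rewrite xI.
(* Joining with u adds only the label l, so an x in the interval whose join with u is b has the set
   of b without l. Its set determines x, which gives the uniqueness of h and [ht b = (ht h).+1]. *)
have top_nmi x : x \in ival a b -> x `|` u = b -> mi_notabove x = mi_notabove b :\ l.
  move=> xI xE; have /andP[ax xb] : a < x < b by move: xI; rewrite inE.
  have xl := xuE _ (ltW ax); rewrite xE in xl.
  rewrite xl setU1K //; apply/negP => lx.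
  have bx : b <= x.
    by apply: mi_notabove_le; rewrite ?neq0 ?(ltW ax) // xl subUset sub1set lx subxx.
  by rewrite (le_gtF bx) in xb.
have lb : l \in mi_notabove b.
  by move: hI; rewrite inE => /andP[/ltW/xuE + _]; rewrite huE => ->; apply: setU11.
have /andP[ah hb] : a < h < b by move: hI; rewrite inE.
have htb : ht b = (ht h).+1 by rewrite /ht (cardsD1 l) lb (top_nmi _ hI huE).
have hE x : x \in ival a b -> x `|` u = b -> x = h.
  move=> xI xE; have nE : mi_notabove x = mi_notabove h.
    by rewrite (top_nmi _ xI xE) (top_nmi _ hI huE).
  move: xI; rewrite inE => /andP[/ltW ax _].
  by apply/eqP; rewrite eq_le !mi_notabove_le ?nE // neq0 // ltW.
apply: (@vanishes_del _ _ _ h); first exact: join_complex_dclosed.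
  have -> : [set G in join_complex K (ival a b) | h \notin G] = join_complex K (ival a b :\ h).
    by apply/setP=> G; rewrite inE in_join_complexD1.
  apply: (@vanishes_contract _ _ _ _ _ u) => //.
  - by move=> G x GK xG; rewrite inE negb_and (aK _ _ GK xG) orbT.
  - rewrite !inE au ltub !andbT; apply: contraNneq nub => uh.
    by rewrite -huE -uh joinxx.
  move=> x; rewrite in_setD1 => /andP[xh xI]; rewrite in_setD1 xuI // ?andbT.
    by apply: contraNneq (negbT (lt_eqF hb)) => xuh; rewrite -huE -xuh -joinA joinxx.
  by apply: contraNneq xh => /(hE _ xI) ->.
(* No element lies strictly between h and b, since their degrees differ by one. So the link of h is
   the join of [K] with (a,h), where both the size and the upper degree have dropped by one. *)
move=> q pq; have -> : link (join_complex K (ival a b)) [set h] = join_complex K (ival a h).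
  have sub : ival a h \subset ival a b.
    by apply/subsetP=> x; rewrite !inE => /andP[-> /lt_trans]; apply.
  have hh : h \notin ival a h by rewrite inE ltxx andbF.
  apply/setP=> C; rewrite inE disjoints1 !in_join_complex setDUl setIUl.
  have /setIidPl-> : [set h] \subset ival a b by rewrite sub1set.
  have /eqP-> : [set h] :\: ival a b == set0 by rewrite setD_eq0 sub1set.
  rewrite set0U; apply/and3P/andP => [[hC CK /order_complexP[sC cmp]]|[CK CI]].
    have e : C :&: ival a b = C :&: ival a h.
      apply/setP=> x; rewrite !in_setI; have [xC|//] := boolP (x \in C) => /=.
      apply/idP/idP => [xI|/(subsetP sub)//].
      have /andP[ax xb] : a < x < b by move: xI; rewrite inE.
      rewrite inE ax /= lt_neqAle; apply/andP; split; first by apply: contraNneq hC => <-.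
      have [||hx|//] := cmp h x; rewrite ?setU11 // ?inE ?xC ?ax ?xb ?orbT //.
      have hx' : h < x by rewrite lt_neqAle hx andbT; apply: contraNneq hC => ->.
      have := ht_lt (neq0 _ (ltW ax)) xb.
      by rewrite htb ltnS leqNgt ht_lt // neq0 // ltW.
    split; last first.
      apply/order_complexP; split; first exact: subsetIr.
      by move=> x y; rewrite -e => xC yC; apply: cmp; rewrite in_setU ?xC ?yC orbT.
    by rewrite -(setDIr0 e).
  have e : C :&: ival a b = C :&: ival a h.
    apply/setP=> x; rewrite !in_setI; have [xC|//] := boolP (x \in C) => /=.
    apply/idP/idP => [xI|/(subsetP sub)//]; apply/contraT => xh.
    by have := aK _ x CK; rewrite in_setD xh xC xI => /(_ isT).
  have hC : h \notin C.
    by apply/negP => hC; have := aK _ h CK; rewrite in_setD hh hC hI => /(_ isT).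
  split=> //; first by rewrite (setDIr0 e).
  apply: order_complexU1; rewrite // ?e.
    have /order_complexP[sC cmp] := CI.
    by apply/order_complexP; split=> //; apply: subset_trans sub.
  by move=> y; rewrite !inE => /and3P[_ _ /ltW]; right.
apply: IH => //; first by rewrite htb ltnS in bn.
- by move=> G x GK xG; apply: contra (aK _ _ GK xG); rewrite !inE => /andP[-> /lt_trans]; apply.
by move: pm; rewrite htb pq; clear; lia.
Qed.

End Graded.

(** * Cohen-Macaulayness in terms of lower intervals *)

Section CohenMacaulay.
Local Open Scope order_scope.
Variables (k : fieldType) (disp : Order.disp_t) (T : finTBLatticeType disp).
Implicit Types (a b x y u l : T) (C F : {set T}) (K : {set {set T}}).

Notation rhv := (reduced_homology_vanishes k).
Notation oc := order_complex.

Definition acyclic_intervals d := forall t : T, t != \bot ->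
  forall p, ht t <> (p + d)%N -> rhv (oc (ival \bot t)) p.

(** By minimality of x each element of (0,x) has atoms of one kind only below it, and comparable
    elements share an atom; so the kind is constant on connected components. *)
Lemma ex_mixed_minimal (S : pred T) a1 a2 b : atom a1 -> atom a2 ->
  a1 <= b -> a2 <= b -> S a1 -> ~~ S a2 ->
  exists x c1 c2, [/\ x <= b, atom c1 /\ atom c2, c1 < x /\ c2 < x, S c1 /\ ~~ S c2 &
    ~ rhv (oc (ival \bot x)) 1].
Proof.
move=> aA1 aA2 ab1 ab2 S1 S2.
pose mixed x := [exists c1, exists c2, [&& atom c1, atom c2, c1 <= x, c2 <= x, S c1 & ~~ S c2]].
have mb : mixed b by apply/existsP; exists a1; apply/existsP; exists a2; rewrite aA1 aA2 ab1 ab2 S1.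
have [x [mx xb xm]] := ex_minimal mb.
have /existsP[c1 /existsP[c2 /and5P[cA1 cA2 c1x c2x /andP[Sc1 Sc2]]]] := mx.
have ltx c c' : atom c -> atom c' -> c <= x -> c' <= x -> S c != S c' -> c < x.
  move=> cA cA' cx cx' nS; rewrite lt_neqAle cx andbT; apply: contraNneq nS => e.
  by rewrite -e in cx'; rewrite (atom_le cA (atom_neq0 cA') cx').
exists x, c1, c2; split=> //.
  by split; [apply: (ltx _ c2)|apply: (ltx _ c1)]; rewrite // Sc1 (negPf Sc2).
pose S' y := [exists c, [&& atom c, c <= y & S c]].
have Sat c : atom c -> S' c = S c.
  move=> cA; apply/existsP/idP => [[c' /and3P[cA' cc' Sc']]|Sc].
    by rewrite -(atom_le cA (atom_neq0 cA') cc').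
  by exists c; rewrite cA lexx.
apply: (@disconnected _ _ _ _ S' c1 c2).
- by rewrite inE lt0x atom_neq0 // (ltx _ c2) // Sc1 (negPf Sc2).
- by rewrite inE lt0x atom_neq0 // (ltx _ c1) // Sc1 (negPf Sc2).
- by rewrite Sat.
- by rewrite Sat.
move=> y z yI zI yz; apply/existsP/existsP => -[c /and3P[cA cy Sc]].
  by exists c; rewrite cA Sc (le_trans cy).
have [e eA ey] := ex_atom (ival_bot_neq0 yI).
have [Se|nSe] := boolP (S e); first by exists e; rewrite eA ey.
have /andP[_ zx] : \bot < z < x by move: zI; rewrite inE.
have mz : mixed z.
  by apply/existsP; exists c; apply/existsP; exists e; rewrite cA eA cy (le_trans ey) // Sc.
have zxE : z = x by apply: xm => //; apply: ltW.
by rewrite zxE ltxx in zx.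
Qed.

(** The empty face is a cycle that bounds nothing when there are no vertices. Applied to (0,a) for
    an atom a, this forces [ht a = d]. *)
Lemma order_complex_void : ~ rhv (oc (set0 : {set T})) 0.
Proof.
move=> /vanishesP v0; pose z (G : {set T}) : k^o := (G == set0)%:R%R.
have zE G : z G != 0%R -> G = set0.
  by rewrite /z; case: (G =P set0) => // _; rewrite eqxx.
have [||c cK cz] := v0 z.
- by move=> G /zE->; rewrite order_complex0 cards0.
- move=> G; apply/eqP/contraT => /kosz_neq0[v _ /zE /setP /(_ v)].
  by rewrite !inE eqxx.
have : kosz (fun=> 1%R) c set0 != 0%R by rewrite cz /z eqxx oner_neq0.
case/kosz_neq0 => v _ /cK /andP[/order_complexP[/subsetP/(_ v) + _] _].
by rewrite !inE eqxx => /(_ isT).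
Qed.

Lemma acyclic_ht_atom d a : acyclic_intervals d -> atom a -> ht a = d.
Proof.
move=> acy aA; apply/eqP/contraT => /eqP had; case: order_complex_void.
have <- : ival \bot a = set0; last by apply: acy; rewrite ?atom_neq0.
apply/setP=> x; rewrite !inE; apply/negP => /andP[x0 xa].
have xE : x = a by apply: atom_le (ltW xa); rewrite // -lt0x.
by rewrite xE ltxx in xa.
Qed.

Lemma acyclic_ht_cover d : atomic_lattice T -> acyclic_intervals d ->
  forall a b, covers b a -> a != \bot -> ht b = (ht a).+1.
Proof.
move=> hT acy a b /coversP[ab bm] a0.
have [A [AA bE]] := hT b.
have [a2 [aA2 a2b a2a]] : exists a2, [/\ atom a2, a2 <= b & ~~ (a2 <= a)].
  have [/existsP[c /andP[cA ca]]|] := boolP [exists c, (c \in A) && ~~ (c <= a)].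
    by exists c; split=> //; [apply: AA | rewrite bE; apply: joins_sup].
  rewrite negb_exists => /forallP h; suff : b <= a by rewrite (lt_geF ab).
  by rewrite bE; apply/joinsP => c cA; have := h c; rewrite cA negbK.
have [a1 aA1 a1a] := ex_atom a0.
have [|x [c1 [c2 [xb [cA1 cA2] [c1x c2x] [Sc1 Sc2] nx]]]] :=
  @ex_mixed_minimal (fun c => c <= a) a1 a2 b aA1 aA2 _ a2b a1a a2a.
  by rewrite (le_trans a1a) ?ltW.
have x0 : x != \bot by rewrite -lt0x (le_lt_trans _ c1x) ?le0x.
have hx : ht x = 1 + d.
  by apply/eqP/contraT => /eqP h; case: nx; apply: acy.
have hab := ht_lt a0 ab.
(* The right-hand side is [ht x - ht c1], that is (d + 1) - d = 1. For the inclusion, suppose l lies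
   above a and x but not above b. As b covers a, the meet of l and b is a; it lies above [c2],
   although [c2] is not below a. *)
suff : (#|mi_notabove b :\: mi_notabove a| <= #|mi_notabove x :\: mi_notabove c1|)%N.
  rewrite !cardsDS ?mi_notaboveS ?ltW // -!/(ht _) hx (acyclic_ht_atom acy cA1).
  by move: hab; clear; lia.
apply: subset_leq_card; apply/subsetP => l; rewrite !in_setD !in_mi_notabove.
case: (l \in meet_irr T) => //=; rewrite !negbK => /andP[al bl].
rewrite (le_trans Sc1 al) /=; apply: contra Sc2 => xl.
have le : c2 <= l `&` b by rewrite lexI (le_trans (ltW c2x)) // (le_trans (ltW c2x)).
have [lba|nlba] := eqVneq a (l `&` b); first by rewrite lba.
have : l `&` b = b.
  by apply: bm; rewrite ?leIr // lt_neqAle nlba lexI al ltW.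
by move/meet_idPr; rewrite (negPf bl).
Qed.

Lemma in_link K F C : (C \in link K F) = [disjoint F & C] && (F :|: C \in K).
Proof. by rewrite in_set. Qed.

Lemma link_set0 K : link K set0 = K.
Proof. by apply/setP=> C; rewrite inE set0U disjoints_subset sub0set. Qed.

Lemma link_dclosed K F : dclosed K -> dclosed (link K F).
Proof.
move=> dK C D; rewrite !inE => /andP[FC CK] sD; apply/andP; split.
  by rewrite disjoint_sym (disjointWl sD) // disjoint_sym.
by apply: dK CK _; apply: setUS.
Qed.

(** A vertex of the link is comparable to the top a of the chain: those above a form chains of
    (a,b), those below extend the rest of the chain in (0,a), and the two parts are independent. *)
Lemma link_chain_top b F a : F \in oc (ival \bot b) -> a \in F ->
  {in F, forall x, x <= a} ->
  link (oc (ival \bot b)) F = join_complex (link (oc (ival \bot a)) (F :\ a)) (ival a b).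
Proof.
move=> FP aF am; have /order_complexP[/subsetP sF cF] := FP.
have /andP[a0 ab] : \bot < a < b by have := sF a aF; rewrite inE.
apply/setP=> C; rewrite in_join_complex !in_link.
apply/andP/andP => [[dFC /order_complexP[/subsetP sC cC]]|
  [/andP[dFC /order_complexP[/subsetP sC cC]] /order_complexP[_ cI]]].
  have nF x : x \in C -> x \notin F.
    by move=> xC; apply/negP => xF; rewrite (disjointFr dFC xF) in xC.
  have low x : x \in C -> x \notin ival a b -> x < a.
    move=> xC xI; have xa : x != a by apply: contraNneq (nF _ xC) => ->.
    have /andP[_ xb] : \bot < x < b by have := sC x; rewrite !inE xC orbT => /(_ isT).
    have [||le|ax] := cC x a; rewrite ?in_setU ?xC ?aF ?orbT // lt_neqAle ?xa //.
    by case/negP: xI; rewrite inE xb andbT lt_neqAle eq_sym xa.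
  split; last first.
    apply/order_complexP; split; first exact: subsetIr.
    by move=> x y; rewrite !inE => /andP[xC _] /andP[yC _]; apply: cC; rewrite inE ?xC ?yC orbT.
  apply/andP; split.
    by apply: disjointW dFC; rewrite ?subD1set ?subsetDl.
  apply/order_complexP; split.
    apply/subsetP=> x; rewrite in_setU in_setD1 in_setD => /orP[/andP[xa xF]|/andP[xI xC]].
      have := sF x xF; rewrite [in X in X -> _]inE inE => /andP[-> _] /=.
      by rewrite lt_neqAle xa am.
    rewrite inE low // andbT; have := sC x; rewrite !inE xC orbT => /(_ isT).
    by case/andP.
  move=> x y; rewrite !in_setU !in_setD1 !in_setD => xC yC; apply: cC; rewrite in_setU.
    by case/orP: xC => /andP[_ ->]; rewrite ?orbT.
  by case/orP: yC => /andP[_ ->]; rewrite ?orbT.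
have dec x : x \in F :|: C ->
    [\/ x \in F :\ a :|: C :\: ival a b, x = a | x \in C :&: ival a b].
  rewrite !in_setU in_setD1 in_setD in_setI; have [->|xa] := eqVneq x a; first by constructor 2.
  case/orP => [->|xC]; first by constructor 1.
  by rewrite xC; case: (x \in ival a b); [constructor 3|constructor 1; rewrite orbT].
have low x : x \in F :\ a :|: C :\: ival a b -> \bot < x < a.
  by move=> xL; have := sC x xL; rewrite inE.
have aC : a \notin C.
  apply/negP => aC; have := low a; rewrite !inE eqxx aC !ltxx /= andbF => /(_ isT).
  by [].
split.
  apply/pred0P => x /=; apply/negP => /andP[xF xC].
  have xa : x != a by apply: contraNneq aC => <-.
  have xI : x \notin ival a b by rewrite inE (le_gtF (am x xF)).
  have xFa : x \in F :\ a by rewrite in_setD1 xa.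
  by have := disjointFr dFC xFa; rewrite in_setD xI xC.
apply/order_complexP; split.
  apply/subsetP=> x /dec[/low/andP[x0 xa]|->|].
  - by rewrite inE x0 (lt_trans xa).
  - by rewrite inE a0.
  by rewrite in_setI inE => /and3P[_ /(lt_trans a0)]; rewrite inE => -> ->.
move=> x y /dec[xL|->|xH] /dec[yL|->|yH].
- exact: cC.
- by left; have /andP[_ /ltW] := low _ xL.
- have /andP[_ /ltW xa] := low _ xL; left; apply: le_trans xa _.
  by move: yH; rewrite !inE => /and3P[_ /ltW].
- by right; have /andP[_ /ltW] := low _ yL.
- by left.
- by left; move: yH; rewrite !inE => /and3P[_ /ltW].
- have /andP[_ /ltW ya] := low _ yL; right; apply: le_trans ya _.
  by move: xH; rewrite !inE => /and3P[_ /ltW].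
- by right; move: xH; rewrite !inE => /and3P[_ /ltW].
exact: cI.
Qed.

Lemma acyclic_vanishes_link d b F p : atomic_lattice T -> acyclic_intervals d ->
  b != \bot -> F \in oc (ival \bot b) -> (p + d + #|F| < ht b)%N ->
  rhv (link (oc (ival \bot b)) F) p.
Proof.
move=> hT acy; have hcov := acyclic_ht_cover hT acy.
move: {2}#|F|.+1 (ltnSn #|F|) => n; elim: n b F p => // n IH b F p Fn b0 FP.
have [->|F0] := eqVneq F set0.
  by rewrite cards0 addn0 link_set0 => h; apply: acy => // e; rewrite e ltnn in h.
have [a aF am] := chain_top FP F0; rewrite (link_chain_top FP aF am).
have aI : a \in ival \bot b by have /order_complexP[/subsetP sF _] := FP; apply: sF.
have a0 := ival_bot_neq0 aI; have /andP[_ ab] : \bot < a < b by move: aI; rewrite inE.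
move: Fn; rewrite (cardsD1 a) aF add1n ltnS => Fn ph.
(* By induction the link of [F :\ a] in (0,a) vanishes below [ht a - d - #|F :\ a|]; the shift by
   [ht b - ht a - 1] turns this into the bound [ht b - d - #|F|]. *)
apply: (@vanishes_join_ival _ _ _ hcov _ _ _ (ht a - d - #|F :\ a|)) => //.
- exact/link_dclosed/order_complex_dclosed.
- move=> G x; rewrite in_link => /andP[_ /order_complexP[/subsetP sG _]] xG.
  have := sG x; rewrite in_setU xG orbT => /(_ isT); rewrite !inE => /andP[_ /ltW xa].
  by rewrite (le_gtF xa).
- move=> q qm; apply: IH => //; first exact: chainD1_ival FP aF am.
  by move: qm; move: #|F :\ a| (ht a) => u v; clear; lia.
by move: ph; move: #|F :\ a| (ht a) (ht b) => u v w; clear; lia.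
Qed.

Lemma acyclic_cohen_macaulay d : atomic_lattice T -> acyclic_intervals d ->
  cohen_macaulay_poset k (proper_part T).
Proof.
move=> hT acy F FP p pm; rewrite proper_part_ival in FP pm *.
(* In the one-element lattice the only chain is empty, so no p is below the maximal face size. *)
have [e|top0] := eqVneq (\top : T) \bot.
  suff G0 G : G \in link (oc (ival \bot (\top : T))) F -> #|G| = 0.
    by move: pm; rewrite ltnNge; case/negP; apply/bigmax_leqP => G /G0->.
  rewrite in_link => /andP[_ /order_complexP[/subsetP sG _]]; apply: eq_card0 => x.
  apply/negP => xG; have := sG x; rewrite !inE (xG : x \in G) orbT e ltx0 andbF.
  by move=> /(_ isT).
apply: (acyclic_vanishes_link hT acy) => //.
have : (max_face_size (link (oc (ival \bot (\top : T))) F) <= ht (\top : T) - d - #|F|)%N.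
  apply/bigmax_leqP => G; rewrite in_link => /andP[dFG FG].
  have [a [aA _]] := chain_ht top0 FG; rewrite (acyclic_ht_atom acy aA).
  move: dFG; rewrite -leq_card_setU => /eqP->.
  by move: #|F| #|G| (ht _) => u v w; clear; lia.
by move: pm; move: #|F| (ht _) (max_face_size _) => u v w; clear; lia.
Qed.

Lemma lower_interval_link b : b != \bot ->
  exists2 F, F \in oc (proper_part T) & link (oc (proper_part T)) F = oc (ival \bot b).
Proof.
(* A largest chain of [b,1) contains b, which confines its link to the elements below b. For b the
   top both [U] and the chain are empty, and the link is the whole complex. *)
move=> b0; pose U := [set x : T | b <= x < \top].
have [F FU Fm] := arg_maxnP (fun F => #|F|) (order_complex0 U : set0 \in _).
have UP : U \subset proper_part T.
  apply/subsetP=> x; rewrite proper_part_ival !inE lt0x => /andP[bx ->]; rewrite andbT.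
  by apply: contraNneq b0 => x0; rewrite x0 lex0 in bx.
have /order_complexP[/subsetP sF cF] := FU.
have Fmax x : x \in U -> {in F, forall y, x <= y \/ y <= x} -> x \in F.
  move=> xU xF; apply/contraT => nxF.
  by have := Fm _ (order_complexU1 FU xU xF); rewrite /= cardsU1 nxF ltnn.
have bF : b != \top -> b \in F.
  move=> bT; apply: Fmax => [|y /sF]; first by rewrite inE lexx ltx1.
  by rewrite inE => /andP[by_ _]; left.
exists F.
  by apply/order_complexP; split=> //; apply: subset_trans UP; apply/subsetP.
apply/setP=> C; rewrite in_link; apply/andP/order_complexP.
  move=> [dFC /order_complexP[/subsetP sC cC]]; split; last first.
    by move=> x y xC yC; apply: cC; rewrite in_setU ?xC ?yC orbT.
  apply/subsetP=> x xC; have := sC x; rewrite in_setU xC orbT => /(_ isT).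
  rewrite proper_part_ival !inE => /andP[-> xT] /=.
  have [->//|bT] := eqVneq b \top.
  have xb : x != b by apply: contraTneq xC => ->; rewrite (disjointFr dFC) ?bF.
  have [||bx|xleb] := cC b x; rewrite ?in_setU ?xC ?bF ?orbT // ?lt_neqAle ?xb //.
  have xF : x \in F.
    by apply: Fmax => [|y yF]; [rewrite inE bx | apply: cC; rewrite in_setU ?xC ?yF ?orbT].
  by rewrite (disjointFr dFC xF) in xC.
move=> [/subsetP sC cC]; have low x y : x \in C -> y \in F -> x < y.
  by move=> /sC; rewrite inE => /andP[_ xb] /sF; rewrite inE => /andP[/(lt_le_trans xb)].
split.
  by apply/pred0P => x /=; apply/negP => /andP[xF xC]; have := low x x xC xF; rewrite ltxx.
apply/order_complexP; split.
  rewrite subUset (subset_trans _ UP) /=; last exact/subsetP.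
  apply/subsetP=> x /sC; rewrite proper_part_ival !inE => /andP[-> xb].
  by rewrite (lt_le_trans xb) ?lex1.
move=> x y /setUP[xF|xC] /setUP[yF|yC].
- exact: cF.
- by right; rewrite ltW ?low.
- by left; rewrite ltW ?low.
exact: cC.
Qed.

Lemma cohen_macaulay_interval b p : cohen_macaulay_poset k (proper_part T) -> b != \bot ->
  p != max_face_size (oc (ival \bot b)) -> rhv (oc (ival \bot b)) p.
Proof.
move=> cm b0; have [F FP Fb] := lower_interval_link b0.
rewrite neq_ltn => /orP[|pm].
  by rewrite -Fb; apply: cm.
apply: vanishes_size => G GP; apply: contraTneq pm => <-; rewrite -leqNgt.
exact: leq_bigmax_cond.
Qed.

(** Cohen-Macaulayness leaves homology of (0,x) only in the top size. So a disconnected (0,x) has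
    only one-element chains besides the empty one, and all atoms strictly below x have degree
    [ht x - 1], contrary to the choice of two different degrees. *)
Lemma graded_atoms : (forall a b : T, covers b a -> a != \bot -> ht b = (ht a).+1) ->
  cohen_macaulay_poset k (proper_part T) ->
  forall a1 a2 : T, atom a1 -> atom a2 -> ht a1 = ht a2.
Proof.
move=> hcov cm a1 a2 aA1 aA2; apply/eqP/contraT => ha.
have [||||x [c1 [c2 [_ [cA1 cA2] [c1x c2x] [/eqP S1 S2] nx]]]] :=
  @ex_mixed_minimal (fun c => ht c == ht a1) a1 a2 \top aA1 aA2;
  rewrite ?lex1 // 1?eq_sym //.
have x0 : x != \bot by rewrite -lt0x (le_lt_trans _ c1x) ?le0x.
have m1 : max_face_size (oc (ival \bot x)) = 1%N.
  by apply/esym/eqP/contraT => m; case: nx; apply: cohen_macaulay_interval.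
have hx c : atom c -> c < x -> ht x = (ht c).+1.
  move=> cA cx; have [C CP sC] := saturated_chain hcov cA (ltW cx).
  have : (#|C| <= 1)%N by rewrite -m1; apply: leq_bigmax_cond.
  by rewrite sC; move: (ht_lt (atom_neq0 cA) cx); move: (ht c) (ht x) => u v; clear; lia.
by have := hx _ cA1 c1x; rewrite (hx _ cA2 c2x) => -[e]; rewrite e S1 eqxx in S2.
Qed.

Lemma cohen_macaulay_acyclic :
  (forall a b : T, covers b a -> a != \bot -> ht b = (ht a).+1) ->
  cohen_macaulay_poset k (proper_part T) -> exists d, acyclic_intervals d.
Proof.
move=> hcov cm; have hA := graded_atoms hcov cm.
have [e|t0] := eqVneq (\top : T) \bot.
  by exists 0 => t; rewrite -lex0 -e lex1.
have [a aA _] := ex_atom t0; exists (ht a) => b b0 p hp.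
apply: cohen_macaulay_interval => //; apply: contra_notN hp => /eqP->.
suff -> : max_face_size (oc (ival \bot b)) = (ht b - ht a)%N.
  have [c cA cb] := ex_atom b0.
  by rewrite subnK // (hA _ _ aA cA) ht_le.
apply/eqP; rewrite eqn_leq; apply/andP; split.
  apply/bigmax_leqP => G /(chain_ht b0)[c [cA _]].
  by rewrite (hA _ _ cA aA); move: (ht a) (ht b) => u v; clear; lia.
have [c cA cb] := ex_atom b0; have [C CP sC] := saturated_chain hcov cA cb.
by rewrite (hA _ _ aA cA) -sC; apply: leq_bigmax_cond.
Qed.

Lemma acyclic_intervalsP : atomic_lattice T ->
  (exists d, acyclic_intervals d) <->
  cohen_macaulay_poset k (proper_part T) /\
  (forall a b : T, covers b a -> a != \bot -> ht b = (ht a).+1).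
Proof.
move=> hT; split=> [[d acy]|[cm hcov]]; last exact: cohen_macaulay_acyclic.
by split; [apply: acyclic_cohen_macaulay acy | apply: acyclic_ht_cover acy].
Qed.

End CohenMacaulay.

(** * The crosscut complex of a lower interval *)

Section Crosscut.
Local Open Scope order_scope.
Variables (k : fieldType) (disp : Order.disp_t) (T : finTBLatticeType disp).
Variables (I : finType) (f : I -> T).
Hypothesis f_sep : forall x y : T, y != \bot -> ~~ (x <= y) ->
  exists2 i, y <= f i & ~~ (x <= f i).
Variable t : T.
Hypothesis t0 : t != \bot.

Notation rhv := (reduced_homology_vanishes k).
Notation oc := order_complex.

(** The crosscut complex of (0,t) for the meets of t with those [f i] that are not above t: faces
    are the families with a nonzero lower bound. Indices are used as vertices because different i
    may give the same meet. *)
Definition lower_bounded : {set {set I}} :=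
  [set F : {set I} | [forall i in F, ~~ (t <= f i)] &&
     [exists x : T, [&& x != \bot, x <= t & [forall i in F, x <= f i]]]].

Lemma lower_boundedP (F : {set I}) : reflect
  ((forall i, i \in F -> ~~ (t <= f i)) /\
   exists x : T, [/\ x != \bot, x <= t & forall i, i \in F -> x <= f i])
  (F \in lower_bounded).
Proof.
rewrite inE; apply: (iffP andP) => -[h1 h2]; split.
- by move=> i iF; have /forallP/(_ i)/implyP := h1; apply.
- case/existsP: h2 => x /and3P[x0 xt /forallP h]; exists x; split=> // i.
  by have /implyP := h i.
- by apply/forallP => i; apply/implyP; apply: h1.
case: h2 => x [x0 xt h]; apply/existsP; exists x; rewrite x0 xt.
by apply/forallP => i; apply/implyP; apply: h.
Qed.

Lemma lower_bounded_dclosed : dclosed lower_bounded.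
Proof.
move=> F G /lower_boundedP[h1 [x [x0 xt h]]] /subsetP sG; apply/lower_boundedP.
by split=> [i /sG /h1//|]; exists x; split=> // i /sG /h.
Qed.

(* Interpolates between [Q] and the order complex of [P]: the vertices of either
   factor can be removed one by one, every time along a cone. *)
Definition mixed (Q : {set {set I}}) (P : {set T}) : {set {set I + T}} :=
  [set A : {set I + T} | [&& inl @^-1: A \in Q, inr @^-1: A \in oc P &
     [forall i : I, forall x : T, (inl i \in A) ==> (inr x \in A) ==> (x <= f i)]]].

Implicit Types (Q : {set {set I}}) (P : {set T}).

Lemma mixedP Q P (A : {set I + T}) : reflect
  [/\ inl @^-1: A \in Q, inr @^-1: A \in oc P &
     forall i x, inl i \in A -> inr x \in A -> x <= f i]
  (A \in mixed Q P).
Proof.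
rewrite [A \in _]in_set; apply: (iffP and3P) => -[AQ AP h]; split=> //.
  by move=> i x iA xA; have /forallP/(_ i)/forallP/(_ x) := h; rewrite iA xA.
apply/forallP => i; apply/forallP => x.
by apply/implyP => iA; apply/implyP; apply: h.
Qed.

Lemma mixed_dclosed Q P : dclosed Q -> dclosed (mixed Q P).
Proof.
move=> dQ A B /mixedP[AQ AP h] sB; apply/mixedP; split.
- exact: dQ AQ (preimsetS _ sB).
- exact: order_complex_dclosed AP (preimsetS _ sB).
by move=> i x /(subsetP sB) iA /(subsetP sB); apply: h.
Qed.

Lemma preim_inl_U1l i (A : {set I + T}) : inl @^-1: (inl i |: A) = i |: inl @^-1: A.
Proof. by apply/setP=> j; rewrite !inE. Qed.

Lemma preim_inr_U1l i (A : {set I + T}) : inr @^-1: (inl i |: A) = inr @^-1: A.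
Proof. by apply/setP=> j; rewrite !inE. Qed.

Lemma preim_inl_U1r x (A : {set I + T}) : inl @^-1: (inr x |: A) = inl @^-1: A.
Proof. by apply/setP=> j; rewrite !inE. Qed.

Lemma preim_inr_U1r x (A : {set I + T}) : inr @^-1: (inr x |: A) = x |: inr @^-1: A.
Proof. by apply/setP=> j; rewrite !inE. Qed.

(** A maximal x of [P] is removed first. An index l with [f l] above x but not above t can be
    toggled in each face through x, since all other poset elements of the face lie below x. *)
Lemma mixed_remove_r (P : {set T}) p : P \subset ival \bot t ->
  rhv (mixed lower_bounded P) p <-> rhv (mixed lower_bounded set0) p.
Proof.
move: {2}#|P|.+1 (ltnSn #|P|) => n; elim: n P => // n IH P Pn sP.
have [->//|/set0Pn[x1 x1P]] := eqVneq P set0.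
have [x [/= xP _ xm]] := @ex_maximal _ _ (mem P) _ x1P.
have xI := subsetP sP _ xP; have /andP[_ xt] : \bot < x < t by move: xI; rewrite inE.
have x0 := ival_bot_neq0 xI.
have [l xl tl] : exists2 i, x <= f i & ~~ (t <= f i).
  by apply: f_sep; rewrite // lt_geF.
have mx A : A \in mixed lower_bounded P -> inr x \notin A ->
    A \in mixed lower_bounded (P :\ x).
  move=> /mixedP[AQ /order_complexP[sA cA] h] xA; apply/mixedP; split=> //.
  by apply/order_complexP; split=> //; rewrite subsetD1 sA inE.
have mnx A : A \in mixed lower_bounded (P :\ x) -> inr x \notin A.
  move=> /mixedP[_ /order_complexP[/subsetP sA _] _]; apply/negP => xA.
  by have := sA x; rewrite !inE xA eqxx => /(_ isT).
have dm P' : dclosed (mixed lower_bounded P').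
  exact/mixed_dclosed/lower_bounded_dclosed.
rewrite -(IH (P :\ x)); last 2 first.
- by move: Pn; rewrite (cardsD1 x) xP.
- by apply: subset_trans sP; apply: subD1set.
apply: (@vanishes_toggle _ _ _ _ (inl l)) => //.
  apply/subsetP=> A /mixedP[AQ /order_complexP[sA cA] h]; apply/mixedP; split=> //.
  by apply/order_complexP; split=> //; apply: subset_trans sA (subD1set _ _).
move=> A AP; move/(contra (mx A AP)); rewrite negbK => xA.
have /mixedP[AQ /[dup] AoP /order_complexP[/subsetP sA cA] h] := AP.
apply/and3P; split; last 2 first.
- by apply: (contraL (@mnx _)); rewrite in_setU xA orbT.
- by apply: (contraL (@mnx _)); rewrite in_setD1 xA.
apply/mixedP; split.
- rewrite preim_inl_U1l; apply/lower_boundedP; case/lower_boundedP: AQ => AQ _; split.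
    by move=> i /setU1P[->//|/AQ].
  exists x; split=> //; first exact: ltW.
  by move=> i /setU1P[->//|]; rewrite inE => iA; apply: h.
- by rewrite preim_inr_U1l.
move=> i y; rewrite !in_setU1 => /orP[/eqP[->]|iA] /= yA; last exact: h.
have [||yx|xy] := cA y x; rewrite ?inE //; first exact: le_trans xl.
by rewrite (xm y) // sA // inE.
Qed.

(** On this side whole faces are removed, largest first. For a nonempty face [F] the meet e of t and
    all its [f i] lies in (0,t) and above every poset element that can accompany [F], so e can be
    toggled. *)
Lemma mixed_remove_l (Q : {set {set I}}) p :
  dclosed Q -> set0 \in Q -> Q \subset lower_bounded ->
  rhv (mixed Q (ival \bot t)) p <-> rhv (mixed [set set0] (ival \bot t)) p.
Proof.
move: {2}#|Q|.+1 (ltnSn #|Q|) => n; elim: n Q => // n IH Q Qn dQ Q0 sQ.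
have [F FQ Fm] := arg_maxnP (fun F : {set I} => #|F|) Q0.
have {}FQ : F \in Q := FQ.
have [F0|F0] := eqVneq F set0.
  suff -> : Q = [set set0] by [].
  apply/setP=> G; rewrite inE; apply/idP/eqP => [/Fm|->//].
  by rewrite F0 /= cards0 leqn0 cards_eq0 => /eqP.
have dQF : dclosed (Q :\ F).
  move=> G H; rewrite !in_setD1 => /andP[GF GQ] sH; rewrite (dQ _ _ GQ sH) andbT.
  apply: contraNneq GF => HF; rewrite HF in sH.
  by rewrite eq_sym eqEcard sH; apply: Fm.
rewrite -(IH (Q :\ F)) //; last 3 first.
- by move: Qn; rewrite (cardsD1 F) FQ.
- by rewrite in_setD1 eq_sym F0.
- by apply: subset_trans sQ; apply: subD1set.
have /lower_boundedP[Ft [x [x0 xt xF]]] := subsetP sQ _ FQ.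
pose e := t `&` \meet_(i in F) f i.
have xe : x <= e by rewrite lexI xt; apply/meetsP.
have eF i : i \in F -> e <= f i by move=> iF; rewrite leIx2 // meets_inf ?orbT.
have e0 : e != \bot by apply: contraNneq x0 => e0; rewrite e0 lex0 in xe.
have et : e < t.
  have /set0Pn[i iF] := F0; rewrite lt_neqAle leIl andbT.
  by apply: contraNneq (Ft _ iF) => <-; apply: eF.
have mF A : A \in mixed Q (ival \bot t) ->
    (A \in mixed (Q :\ F) (ival \bot t)) = (inl @^-1: A != F).
  move=> /mixedP[AQ AP h]; apply/mixedP/idP => [[+ _ _]|AF].
    by rewrite in_setD1 => /andP[].
  by split=> //; rewrite in_setD1 AF.
apply: (@vanishes_toggle _ _ _ _ (inr e)).
- exact: mixed_dclosed.
- exact: mixed_dclosed.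
- apply/subsetP=> A /mixedP[AQ AP h]; apply/mixedP; split=> //.
  by move: AQ; rewrite in_setD1 => /andP[].
move=> A AP; rewrite mF // negbK => /eqP AF.
have /mixedP[AQ /[dup] AoP /order_complexP[/subsetP sA cA] h] := AP.
have AeP : inr e |: A \in mixed Q (ival \bot t).
  apply/mixedP; split; rewrite ?preim_inl_U1r // ?preim_inr_U1r.
    apply: order_complexU1 => //; first by rewrite inE lt0x e0.
    move=> y yA; right; rewrite lexI; apply/andP; split.
      by have := sA y yA; rewrite inE => /andP[_ /ltW].
    apply/meetsP => i; rewrite -AF inE => iA; apply: h => //.
    by move: yA; rewrite inE.
  move=> i y; rewrite !in_setU1 /= => iA /orP[/eqP[->]|]; last exact: h.
  by apply: eF; rewrite -AF inE.
rewrite AeP mF // preim_inl_U1r AF eqxx /= mF.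
  by rewrite negbK; apply/eqP; rewrite -AF; apply/setP=> i; rewrite !inE.
exact: (mixed_dclosed dQ AP (subD1set _ _)).
Qed.

Lemma mixed_set0r : mixed lower_bounded set0 = [set @inl I T @: F | F : {set I} in lower_bounded].
Proof.
apply/setP=> A; apply/mixedP/imsetP => [[AQ /order_complexP[sA _] _]|[F FQ ->]].
  exists (inl @^-1: A) => //; apply/setP=> -[i|x].
    by rewrite mem_imset ?inE //; apply: inl_inj.
  have /subsetP/(_ x) := sA; rewrite !inE => xA.
  by apply/idP/imsetP => [/xA//|[]].
have e : inl @^-1: (inl @: F : {set I + T}) = F.
  by apply/setP=> i; rewrite inE mem_imset //; apply: inl_inj.
have e' : inr @^-1: (inl @: F : {set I + T}) = set0.
  by apply/setP=> x; rewrite !inE; apply/imsetP => -[].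
by rewrite e e' order_complex0; split=> // i x _ /imsetP[].
Qed.

Lemma mixed_set0l P : mixed [set set0] P = [set @inr I T @: C | C : {set T} in oc P].
Proof.
apply/setP=> A; apply/mixedP/imsetP => [[/set1P A0 AP _]|[C CP ->]].
  exists (inr @^-1: A) => //; apply/setP=> -[i|x].
    have /setP/(_ i) := A0; rewrite !inE => ->.
    by apply/esym/imsetP => -[].
  by rewrite mem_imset ?inE //; apply: inr_inj.
have e : inr @^-1: (inr @: C : {set I + T}) = C.
  by apply/setP=> i; rewrite inE mem_imset //; apply: inr_inj.
have e' : inl @^-1: (inr @: C : {set I + T}) = set0.
  by apply/setP=> x; rewrite !inE; apply/imsetP => -[].
by rewrite e e' set11; split=> // i x /imsetP[].
Qed.

Lemma vanishes_lower_bounded p :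
  rhv lower_bounded p <-> rhv (oc (ival \bot t)) p.
Proof.
rewrite -(vanishes_imset k (@inl_inj I T) (@enum_rank_inl I T)) -mixed_set0r.
rewrite -(mixed_remove_r _ (subxx _)) mixed_remove_l ?subxx //.
- rewrite mixed_set0l vanishes_imset //; [exact: inr_inj | exact: enum_rank_inr].
- exact: lower_bounded_dclosed.
by apply/lower_boundedP; split=> [i|]; rewrite ?inE //; exists t; split=> // i; rewrite inE.
Qed.

End Crosscut.

(** * Koszul chains over the polynomial ring *)

Section Slices.
Local Open Scope ring_scope.
Variables (k : fieldType) (n : nat).
Notation S := {mpoly k[n]}.
Notation V := ('I_n).
Implicit Types (G H : {set V}) (m : 'X_{1..n}) (c : {set V} -> S^o).

Notation d := (@kosz V k k^o (fun=> 1)).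
Notation dX := (kosz (fun v : V => 'X_v : S)).

Lemma mesym1E G i : mesym1 G i = (i \in G) :> nat.
Proof. by rewrite mnmE. Qed.

Lemma mcoeff_XM m (v : V) (f : S) :
  ('X_v * f)@_m = if (0 < m v)%N then f@_(m - U_(v))%MM else 0.
Proof.
rewrite mulrC; case: ifPn => [mv|].
  have {1}-> : m = (U_(v) + (m - U_(v)))%MM; last by rewrite mcoeffMX.
  by rewrite addmC submK //; apply/mnm_lepP => i; rewrite mnm1E; case: eqP => [<-|].
rewrite -leqNgt leqn0 => /eqP mv; apply: memN_msupp_eq0; apply/negP.
rewrite (perm_mem (msuppMX _ _)) => /mapP[m' _ mE].
by move: mv; rewrite mE mnmDE mnm1E eqxx add1n.
Qed.

Lemma mesym1U1 v G : v \notin G -> mesym1 (v |: G) = (mesym1 G + U_(v))%MM.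
Proof.
move=> vG; apply/mnmP=> i; rewrite mnmDE !mesym1E mnm1E !inE eq_sym.
by case: eqP => [<-|_]; rewrite ?(negPf vG) ?addn0.
Qed.

Lemma mesym1U1_le v G m : v \notin G ->
  (mesym1 (v |: G) <= m)%MM = (mesym1 G <= m)%MM && (0 < (m - mesym1 G)%MM v)%N.
Proof.
move=> vG; apply/mnm_lepP/andP => [h|[/mnm_lepP h mv] i].
  split; first by apply/mnm_lepP => i; apply: leq_trans (h i); rewrite mesym1U1 // mnmDE leq_addr.
  by have := h v; rewrite mnmBE !mesym1E setU11 (negPf vG) subn0.
rewrite mesym1U1 // mnmDE mnm1E; case: eqP => [<-|_]; last by rewrite addn0.
by move: mv (h v); rewrite mnmBE; clear; lia.
Qed.

Lemma osgn_mpolyC v G : osgn S v G = (osgn k v G)%:MP.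
Proof. by rewrite /osgn rmorphXn rmorphN1. Qed.

(* The part of multidegree [m] of a Koszul chain, where the basis vector of [G]
   has multidegree [mesym1 G]. *)
Definition slice c m G : k^o :=
  if (mesym1 G <= m)%MM then (c G)@_(m - mesym1 G) else 0.

(** Multiplication by ['X_v] shifts the multidegree just as adding v to G does, so within a
    multidegree only the signs remain. *)
Lemma slice_kosz c m G : slice (dX c) m G = d (slice c m) G.
Proof.
rewrite /slice; case: ifPn => Gm; last first.
  apply/esym/big1 => v vG; rewrite mesym1U1_le // (negPf Gm) scaler0 //.
rewrite /kosz raddf_sum; apply: eq_bigr => v vG /=.
rewrite mesym1U1_le // Gm /= mulr1 /GRing.scale /= -mulrA osgn_mpolyC mcoeffCM mcoeff_XM.
by congr (_ * _); rewrite mesym1U1 // submDA.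
Qed.

Lemma mcoeff_slice c m G : (c G)@_m = slice c (m + mesym1 G)%MM G.
Proof. by rewrite /slice lem_addl addmK. Qed.

Lemma sliceP c c' : (forall m, slice c m =1 slice c' m) -> c =1 c'.
Proof. by move=> h G; apply/mpolyP => m; rewrite !mcoeff_slice h. Qed.

(** The upper Koszul simplicial complex of the monomial ideal with exponents [P]; [predT] stands for
    the ring itself. *)
Definition koszul_cpx (P : pred 'X_{1..n}) m : {set {set V}} :=
  [set G | (mesym1 G <= m)%MM && P (m - mesym1 G)%MM].

Lemma mdeg_sub m m' : (m <= m')%MM -> (mdeg (m' - m) + mdeg m = mdeg m')%N.
Proof. by move=> h; rewrite -mdegD submK. Qed.

Lemma slice_neq0_deg c m G : slice c m G != 0 ->
  exists2 q, (c G)@_q != 0 & (mdeg q + #|G| = mdeg m)%N.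
Proof.
rewrite /slice; case: ifP => [Gm h|]; last by rewrite eqxx.
by exists (m - mesym1 G)%MM => //; rewrite -(mdeg_mesym1 G) mdeg_sub.
Qed.

(** The equation is solved one multidegree at a time. The solution uses only multidegrees that occur
    in c, which later makes it inherit homogeneity. *)
Lemma kosz_fill (P : pred 'X_{1..n}) c (p : nat) :
  (forall G, c G != 0 -> #|G| == p) ->
  (forall G m, (c G)@_m != 0 -> P m) ->
  (forall G, dX c G = 0) ->
  (forall m G, slice c m G != 0 -> reduced_homology_vanishes k (koszul_cpx P m) p) ->
  exists b : {set V} -> S^o,
    [/\ forall G, b G != 0 -> #|G| == p.+1,
        forall G m, (b G)@_m != 0 -> P m /\ exists H, slice c (m + mesym1 G)%MM H != 0
      & dX b =1 c].
Proof.
move=> cp cP c0 cv.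
(* A multidegree of c is an exponent of a coefficient plus a face with at most n vertices, so its
   degree is below [B]. The type of such multidegrees is finite, and all solutions can be chosen at
   once. *)
pose B := ((\max_G msize (c G)) + n).+1.
have sB m G : slice c m G != 0 -> (mdeg m < B)%N.
  move=> /slice_neq0_deg[q cq <-]; rewrite ltnS; apply: leq_add.
    apply: leq_trans (leq_bigmax G); rewrite ltnW // msize_mdeg_lt //.
    by rewrite mcoeff_msupp.
  by rewrite -[n in (_ <= n)%N]card_ord max_card.
have [b hb] : exists b : 'X_{1..n < B} -> {set V} -> k^o, forall m : 'X_{1..n < B},
    [/\ chain (koszul_cpx P m) p.+1 (b m), d (b m) =1 slice c m
      & forall G, b m G != 0 -> exists H, slice c m H != 0].
  apply: (@fin_all_exists _ (fun=> {set V} -> k^o) (fun (m : 'X_{1..n < B}) b =>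
    [/\ chain (koszul_cpx P m) p.+1 b, d b =1 slice c m
      & forall G, b G != 0 -> exists H, slice c m H != 0])) => m.
  have [/existsP[G nG]|] := boolP [exists G, slice c m G != 0]; last first.
    rewrite negb_exists => /forallP h; exists (fun=> 0); split.
    - by move=> G; rewrite eqxx.
    - by move=> G; rewrite kosz0 //; have := h G; rewrite negbK => /eqP.
    by move=> G; rewrite eqxx.
  have /vanishesP v := cv _ _ nG.
  have [||bm bK bm0] := v (slice c m).
  - move=> H; rewrite /slice inE; case: ifP => [Hm|]; last by rewrite eqxx.
    move=> h /=; rewrite (cP _ _ h) cp //; apply: contraNneq h => ->.
    by rewrite mcoeff0.
  - move=> H; rewrite -slice_kosz /slice c0 mcoeff0 if_same //.
  by exists bm; split=> // H _; exists G.
pose bS (G : {set V}) : S^o := \sum_(m : 'X_{1..n < B} | (mesym1 G <= m)%MM)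
    b m G *: 'X_[m - mesym1 G].
have bSE G q : (bS G)@_q =
    \sum_(m : 'X_{1..n < B} | val m == (q + mesym1 G)%MM) b m G.
  rewrite raddf_sum /= [LHS]big_mkcond [RHS]big_mkcond; apply: eq_bigr => m _.
  rewrite mcoeffZ mcoeffX; case: (val m =P _) => [->|ne].
    by rewrite lem_addl addmK eqxx mulr1.
  case: ifP => // Gm; rewrite (_ : _ == _ = false) ?mulr0 //.
  by apply: contra_notF ne => /eqP <-; rewrite submK.
have sbS m G : slice bS m G = if insub (m : 'X_{1..n}) is Some mb then b mb G else 0.
  rewrite /slice; case: ifPn => Gm.
    rewrite bSE submK //; case: insubP => [mb _ <-|nB].
      by rewrite (bigD1 mb) //= big1 ?addr0 // => mb' /andP[/eqP/val_inj->]; rewrite eqxx.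
    by rewrite big_pred0 // => mb; apply: contraNF nB => /eqP<-; apply: bmdeg.
  case: insubP => [mb _ e|//]; apply/esym/eqP/contraT => h.
  by have [/(_ _ h) + _ _] := hb mb; rewrite inE e (negPf Gm).
exists bS; split.
- move=> G; apply: contraNT => Gp; apply/eqP/mpolyP => q; rewrite mcoeff0 bSE.
  apply: big1 => m _; apply/eqP/contraT => h.
  by have [/(_ _ h) + _ _] := hb m; rewrite (negPf Gp) andbF.
- move=> G q; rewrite mcoeff_slice sbS; case: insubP => [mb _ e h|_]; last by rewrite eqxx.
  have [/(_ _ h)/andP[+ _] _ /(_ _ h)] := hb mb.
  by rewrite inE e addmK => /andP[_ ->].
apply: sliceP => m G; rewrite slice_kosz (eq_kosz _ (sbS m)).
case: insubP => [mb _ <-|nB]; first by have [_ ->] := hb mb.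
by rewrite kosz0 //; apply/esym/eqP; apply: contraNT nB; apply: sB.
Qed.

End Slices.

(** * Homogeneous rows and chains with values in a free module *)

Section GradedRows.
Local Open Scope ring_scope.
Variables (k : fieldType) (n : nat).
Notation S := {mpoly k[n]}.
Notation V := ('I_n).
Implicit Types (G H : {set V}) (m : 'X_{1..n}) (p j : nat).

Notation dX := (kosz (fun v : V => 'X_v : S)).

Lemma kosz_entry r (c : {set V} -> 'rV[S]_r) G t :
  dX c G 0 t = dX (fun H => c H 0 t : S^o) G.
Proof. by rewrite summxE; apply: eq_bigr => v _; rewrite mxE. Qed.

Lemma kosz_mulmx r s (A : 'M[S]_(r, s)) (c : {set V} -> 'rV[S]_r) G :
  dX (fun H => c H *m A) G = dX c G *m A.
Proof. by rewrite mulmx_suml; apply: eq_bigr => v _; rewrite scalemxAl. Qed.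

Definition homog_row r (deg : 'I_r -> nat) j (v : 'rV[S]_r) :=
  forall t m, (v 0 t)@_m != 0 -> (mdeg m + deg t = j)%N.

Definition homog_chain r (deg : 'I_r -> nat) j (c : {set V} -> 'rV[S]_r) :=
  forall G t m, (c G 0 t)@_m != 0 -> (mdeg m + deg t + #|G| = j)%N.

(** An equation for each monomial that occurs: no truncated subtraction, and nothing is required of
    zero entries. *)
Definition homog_mx r s (degr : 'I_r -> nat) (degs : 'I_s -> nat) (A : 'M[S]_(r, s)) :=
  forall t u m, (A t u)@_m != 0 -> (mdeg m + degs u = degr t)%N.

Definition sized r p (c : {set V} -> 'rV[S]_r) := forall G, c G != 0 -> #|G| == p.

Lemma row_neq0 r (v : 'rV[S]_r) : v != 0 -> exists t m, (v 0 t)@_m != 0.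
Proof.
move=> v0; have [/existsP[t]|] := boolP [exists t, v 0 t != 0].
  rewrite -msupp_eq0; case e : (msupp _) => [//|m l] _; exists t, m.
  by rewrite -mcoeff_msupp e mem_head.
rewrite negb_exists => /forallP h; case/negP: v0; apply/eqP/rowP => t.
by rewrite mxE; apply/eqP; have := h t; rewrite negbK.
Qed.

(** In multidegree m the complex of the ring is the full simplex on the support of m, a cone unless
    m = 0. Multidegree 0 only meets constant terms at the empty face, which the last hypothesis
    excludes. *)
Lemma kosz_exact r (deg : 'I_r -> nat) j p (c : {set V} -> 'rV[S]_r) :
  sized p c -> (forall G, dX c G = 0) ->
  (p = 0%N -> forall t, (c set0 0 t)@_0 = 0) ->
  exists b, [/\ sized p.+1 b, homog_chain deg j c -> homog_chain deg j b & dX b =1 c].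
Proof.
move=> cp c0 cst.
have [b hb] : exists b : 'I_r -> {set V} -> S^o, forall t,
    [/\ forall G, b t G != 0 -> #|G| == p.+1,
        homog_chain deg j c -> forall G m, (b t G)@_m != 0 -> (mdeg m + deg t + #|G| = j)%N
      & dX (b t) =1 (fun G => c G 0 t : S^o)].
  apply: (@fin_all_exists _ (fun=> {set V} -> S^o) (fun t b => [/\ forall G, b G != 0 -> #|G| == p.+1,
    homog_chain deg j c -> forall G m, (b G)@_m != 0 -> (mdeg m + deg t + #|G| = j)%N
    & dX b =1 (fun G => c G 0 t : S^o)])) => t.
  have [||||b [bp bP bc]] := @kosz_fill _ _ predT (fun G => c G 0 t : S^o) p.
  - by move=> G h; apply: cp; apply: contraNneq h => ->; rewrite mxE.
  - by [].
  - by move=> G; rewrite -kosz_entry c0 mxE.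
  - move=> m G nG; have [m0|m0] := eqVneq m 0%MM.
      have G0 : G = set0.
        have [q _ /eqP] := slice_neq0_deg nG.
        by rewrite m0 mdeg0 addn_eq0 cards_eq0 => /andP[_ /eqP].
      have p0 : p = 0%N.
        have [q cq _] := slice_neq0_deg nG.
        have : c G != 0 by apply: contraNneq cq => ->; rewrite mxE mcoeff0.
        by move=> /cp; rewrite G0 cards0 => /eqP.
      by move: nG; rewrite G0 m0 /slice mesym1_set0 subm0 lepm_refl (cst p0) eqxx.
    have [v mv] : exists v, (0 < m v)%N.
      apply/existsP; apply: contraNT m0; rewrite negb_exists => /forallP h.
      by apply/eqP/mnmP=> i; rewrite mnm0E; apply/eqP; have := h i; rewrite -leqNgt leqn0.
    apply: (@vanishes_apex _ _ _ v) => [G1 H|G1]; rewrite !inE !andbT.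
      move=> /mnm_lepP h /subsetP sH; apply/mnm_lepP => i; apply: leq_trans (h i).
      by rewrite !mesym1E; case: (boolP (i \in H)) => // /sH->.
    move=> /mnm_lepP h; apply/mnm_lepP => i; have := h i.
    by rewrite !mesym1E !inE; case: eqP => [->|].
  exists b; split=> // cj G m /bP[_ [H nH]].
  have [q cq e] := slice_neq0_deg nH; rewrite -(cj H t q) // -!addnA ![(deg t + _)%N]addnC !addnA e.
  by rewrite mdegD mdeg_mesym1.
exists (fun G => \row_t b t G); split.
- move=> G /row_neq0[t [m]]; rewrite mxE => h; have [bp _ _] := hb t.
  by apply: bp; apply: contraNneq h => ->; rewrite mcoeff0.
- by move=> cj G t m; rewrite mxE; have [_ + _] := hb t; apply.
move=> G; apply/rowP => t; rewrite kosz_entry.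
have [_ _ <-] := hb t; apply: eq_bigr => v _; by rewrite mxE.
Qed.

Definition restr (P : pred 'X_{1..n}) (f : S) : S := \sum_(m <- msupp f | P m) f@_m *: 'X_[m].

Lemma mcoeff_restr P f m : (restr P f)@_m = if P m then f@_m else 0.
Proof.
rewrite /restr raddf_sum /=; case: ifPn => Pm; last first.
  apply: big1 => q Pq; rewrite mcoeffZ mcoeffX (_ : _ == _ = false) ?mulr0 //.
  by apply: contraNF Pm => /eqP<-.
have [fm|/eqP nf] := boolP (m \in msupp f).
  rewrite big_mkcond (bigD1_seq m) ?msupp_uniq //= Pm mcoeffZ mcoeffX eqxx mulr1.
  rewrite big1 ?addr0 // => q qm.
  by rewrite mcoeffZ mcoeffX (negPf qm) mulr0 if_same.
rewrite big1_seq; first by apply/esym/memN_msupp_eq0/eqP.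
move=> q /andP[_ fq]; rewrite mcoeffZ mcoeffX (_ : _ == _ = false) ?mulr0 //.
by apply/eqP => e; case: nf; rewrite -e fq.
Qed.

Definition row_part r (deg : 'I_r -> nat) (j : nat) (v : 'rV[S]_r) : 'rV[S]_r :=
  \row_t restr (fun m => mdeg m + deg t == j)%N (v 0 t).

Lemma mcoeff_row_part r (deg : 'I_r -> nat) j v t m :
  (row_part deg j v 0 t)@_m = if (mdeg m + deg t == j)%N then (v 0 t)@_m else 0.
Proof. by rewrite mxE mcoeff_restr. Qed.

Lemma rowmP r (v w : 'rV[S]_r) : (forall t m, (v 0 t)@_m = (w 0 t)@_m) -> v = w.
Proof. by move=> h; apply/rowP => t; apply/mpolyP => m. Qed.

Lemma row_part_homog r (deg : 'I_r -> nat) j v : homog_row deg j (row_part deg j v).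
Proof. by move=> t m; rewrite mcoeff_row_part; case: ifP => [/eqP|_]; rewrite ?eqxx. Qed.

Lemma row_part_id r (deg : 'I_r -> nat) j v : homog_row deg j v -> row_part deg j v = v.
Proof.
move=> h; apply: rowmP => t m; rewrite mcoeff_row_part; case: eqP => // ne.
by apply/esym/eqP/contraT => /h.
Qed.

Lemma row_partD r (deg : 'I_r -> nat) j v w :
  row_part deg j (v + w) = row_part deg j v + row_part deg j w.
Proof.
apply: rowmP => t m; rewrite [(_ + _ : matrix _ _ _) 0 t in RHS]mxE mcoeffD.
by rewrite !mcoeff_row_part mxE mcoeffD; case: ifP; rewrite ?addr0.
Qed.

Lemma row_part_eq0 r (deg : 'I_r -> nat) (j : nat) (v : 'rV[S]_r) :
  (forall t m, (v 0 t)@_m != 0 -> (mdeg m + deg t)%N != j) -> row_part deg j v = 0.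
Proof.
move=> h; apply: rowmP => t m; rewrite mcoeff_row_part mxE mcoeff0; case: eqP => // e.
by apply/eqP/contraT => /h; rewrite e eqxx.
Qed.

Lemma mcoeff_mulmx r s (v : 'rV[S]_r) (A : 'M[S]_(r, s)) u m :
  ((v *m A) 0 u)@_m != 0 ->
  exists t m1 m2, [/\ (v 0 t)@_m1 != 0, (A t u)@_m2 != 0 & m = (m1 + m2)%MM].
Proof.
move=> h; have [/existsP[t]|] := boolP [exists t, (v 0 t * A t u)@_m != 0].
  rewrite -mcoeff_msupp => /msuppM_le /allpairsP[[m1 m2] [/= h1 h2 ->]].
  by exists t, m1, m2; rewrite -!mcoeff_msupp.
rewrite negb_exists => /forallP h0; case/negP: h; rewrite mxE raddf_sum big1 //= => t _.
by apply/eqP; have := h0 t; rewrite negbK.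
Qed.

Section HomogMx.
Variables (r s : nat) (degr : 'I_r -> nat) (degs : 'I_s -> nat) (A : 'M[S]_(r, s)).
Hypothesis hA : homog_mx degr degs A.

Lemma row_part_mulmx j v : row_part degs j (v *m A) = row_part degr j v *m A.
Proof.
have {1}-> : v = row_part degr j v + (v - row_part degr j v) by rewrite addrC subrK.
rewrite mulmxDl row_partD row_part_id => [|u m].
  rewrite [X in _ + X]row_part_eq0 ?addr0 // => u m.
  case/mcoeff_mulmx => t [m1 [m2 [h1 h2 ->]]].
  rewrite mdegD -addnA (hA h2); apply: contraNneq h1 => e.
  by rewrite mxE mcoeffD [(- _ : matrix _ _ _) 0 t]mxE mcoeffN mcoeff_row_part e eqxx subrr.
case/mcoeff_mulmx => t [m1 [m2 [/row_part_homog h1 h2 ->]]].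
by rewrite mdegD -addnA (hA h2).
Qed.

Lemma homog_chain_mulmx j c : homog_chain degr j c ->
  homog_chain degs j (fun G => c G *m A).
Proof.
move=> hc G u m /mcoeff_mulmx[t [m1 [m2 [h1 h2 ->]]]].
by rewrite mdegD -(addnA (mdeg m1)) (hA h2) (hc _ _ _ h1).
Qed.

Lemma sized_mulmx p c : sized p c -> sized p (fun G => c G *m A).
Proof. by move=> cp G h; apply: cp; apply: contraNneq h => ->; rewrite mul0mx. Qed.

End HomogMx.

End GradedRows.

(** * Koszul homology of syzygies *)

Section KoszulVanishing.
Local Open Scope ring_scope.
Variables (k : fieldType) (n : nat).
Notation S := {mpoly k[n]}.
Notation V := ('I_n).
Implicit Types (G H : {set V}) (m : 'X_{1..n}) (p j : nat).

Notation dX := (kosz (fun v : V => 'X_v : S)).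

(* Koszul homology of the submodule [N] vanishes in homological degree [p] and
   total degree [j], the [t]-th basis vector of the free module having degree
   [deg t]. *)
Definition koszul_vanishes r (N : 'rV[S]_r -> Prop) (deg : 'I_r -> nat) p j :=
  forall c, sized p c -> (forall G, N (c G)) -> homog_chain deg j c ->
    (forall G, dX c G = 0) ->
    exists b, [/\ sized p.+1 b, forall G, N (b G) & dX b =1 c].

Lemma koszul_vanishes_iff r (N N' : 'rV[S]_r -> Prop) deg p j :
  (forall v, N v <-> N' v) -> koszul_vanishes N deg p j -> koszul_vanishes N' deg p j.
Proof.
move=> NN h c cp cN cj c0; have [|b [bp bN bc]] := h c cp _ cj c0.
  by move=> G; apply/NN.
by exists b; split=> // G; apply/NN.
Qed.

Lemma sized_kosz r p (c : {set V} -> 'rV[S]_r) : sized p.+1 c -> sized p (dX c).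
Proof.
move=> cp G h; have [/existsP[v /andP[vG /cp]]|] := boolP [exists v, (v \notin G) && (c (v |: G) != 0)].
  by rewrite cardsU1 vG.
rewrite negb_exists => /forallP h0; case/negP: h; apply/eqP/big1 => v vG.
by have := h0 v; rewrite vG /= negbK => /eqP->; rewrite scaler0.
Qed.

Lemma sizedB r p (b c : {set V} -> 'rV[S]_r) : sized p b -> sized p c ->
  sized p (fun G => b G - c G).
Proof.
move=> bp cp G; have [->|/bp//] := eqVneq (b G) 0.
by rewrite sub0r oppr_eq0 => /cp.
Qed.

Lemma kosz_sized0 r (c : {set V} -> 'rV[S]_r) G : sized 0 c -> dX c G = 0.
Proof.
move=> cp; apply: big1 => v vG; have [->|/cp] := eqVneq (c (v |: G)) 0.
  by rewrite scaler0.
by rewrite cardsU1 vG.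
Qed.

Lemma homog_chain_kosz r (deg : 'I_r -> nat) j (c : {set V} -> 'rV[S]_r) :
  homog_chain deg j c -> homog_chain deg j (dX c).
Proof.
move=> cj G t m; rewrite kosz_entry mcoeff_slice slice_kosz => /kosz_neq0[v vG].
move=> /slice_neq0_deg[q /cj <- e]; move: e.
by rewrite mdegD mdeg_mesym1 cardsU1 vG => e; rewrite [RHS]addnAC e addnAC.
Qed.

Lemma homog_chain_row r (deg : 'I_r -> nat) j (c : {set V} -> 'rV[S]_r) G : homog_chain deg j c ->
  (c G != 0 -> (#|G| <= j)%N) /\ homog_row deg (j - #|G|) (c G).
Proof.
move=> cj; split=> [/row_neq0[t [m /cj <-]]|t m /cj <-]; first exact: leq_addl.
by rewrite addnK.
Qed.

Definition rimage r s (A : 'M[S]_(r, s)) (v : 'rV[S]_s) := exists w, v = w *m A.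
Definition rkernel r s (A : 'M[S]_(r, s)) (v : 'rV[S]_r) := v *m A = 0.

Section Shift.
Variables (r s : nat) (degr : 'I_r -> nat) (degs : 'I_s -> nat) (A : 'M[S]_(r, s)).
Hypothesis hA : homog_mx degr degs A.

Lemma lift_sized p (c : {set V} -> 'rV[S]_s) : sized p c ->
  (forall G, rimage A (c G)) -> exists y, sized p y /\ forall G, c G = y G *m A.
Proof.
move=> cp /(@fin_all_exists _ (fun=> 'rV[S]_r) (fun G w => c G = w *m A))[y yE].
exists (fun G => if #|G| == p then y G else 0); split=> [G|G].
  by case: ifP => //; rewrite eqxx.
by case: ifPn => // Gp; rewrite mul0mx; apply/eqP; apply: contraNT Gp; apply: cp.
Qed.

Lemma lift_homog p j (c : {set V} -> 'rV[S]_s) : sized p c -> homog_chain degs j c ->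
  (forall G, rimage A (c G)) ->
  exists y, [/\ sized p y, homog_chain degr j y & forall G, c G = y G *m A].
Proof.
move=> cp cj cA; have [y [yp yE]] := lift_sized cp cA.
(* Each preimage is cut down to its component of degree [j - #|G|]. If [#|G|] exceeds j then [c G]
   is zero, and its lift is set to zero instead of using the truncated difference. *)
exists (fun G => if (#|G| <= j)%N then row_part degr (j - #|G|) (y G) else 0); split=> [G|G t m|G].
- case: ifP => [_|_]; last by rewrite eqxx.
  move=> h; apply: yp; apply: contraNneq h => ->.
  by apply/eqP/row_part_eq0 => t m; rewrite mxE mcoeff0 eqxx.
- case: ifP => [Gj /row_part_homog->|_]; first by rewrite subnK.
  by rewrite mxE mcoeff0 eqxx.
have [Gj hr] := homog_chain_row G cj; case: ifPn => [_|nG].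
  by rewrite -(row_part_mulmx hA) -yE row_part_id.
by rewrite mul0mx; apply/eqP; apply: contraNT nG.
Qed.

(** In homological degree 0, Koszul homology is the module modulo the variables, and no generator
    has degree j. *)
Lemma koszul_vanishes_base j : (forall t, degr t != j) -> koszul_vanishes (rimage A) degs 0 j.
Proof.
move=> hj c cp cA cj _; have [y [yp yj yE]] := lift_homog cp cj cA.
have [|_ t|b [bp _ bE]] := kosz_exact degr j yp.
- by move=> G; apply: kosz_sized0.
- apply/eqP; apply: contraT => /yj; rewrite mdeg0 cards0 addn0 add0n => /eqP.
  by rewrite (negPf (hj t)).
exists (fun G => b G *m A); split.
- exact: sized_mulmx.
- by move=> G; exists (b G).
by move=> G; rewrite kosz_mulmx bE yE.
Qed.

(** The connecting map from the homology of the image in degree p + 1 to that of the kernel in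
    degree p is injective, because the free module is acyclic in degree p + 1. *)
Lemma koszul_vanishes_up p j :
  koszul_vanishes (rkernel A) degr p j -> koszul_vanishes (rimage A) degs p.+1 j.
Proof.
move=> h c cp cA cj c0; have [y [yp yj yE]] := lift_homog cp cj cA.
have dyA G : dX y G *m A = 0.
  by rewrite -kosz_mulmx -(c0 G); apply: eq_kosz => H; rewrite yE.
have [|b [bp bA bE]] := h (dX y) (sized_kosz yp) dyA (homog_chain_kosz yj).
  by move=> G; apply: koszK.
have [||b' [bp' _ bE']] := kosz_exact degr j (sizedB yp bp).
- by move=> G; rewrite koszB bE subrr.
- by [].
exists (fun G => b' G *m A); split.
- exact: sized_mulmx.
- by move=> G; exists (b' G).
by move=> G; rewrite kosz_mulmx bE' mulmxBl (bA G) subr0 yE.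
Qed.

(** The connecting map is also surjective where the free module is acyclic. For p = 0 the constants
    survive in the free module, and the extra hypothesis, minimality of the generators, keeps them
    out of the kernel. *)
Lemma koszul_vanishes_down p j : koszul_vanishes (rimage A) degs p.+1 j ->
  (p = 0%N -> forall v, homog_row degr j v -> v *m A = 0 -> forall t, (v 0 t)@_0 = 0) ->
  koszul_vanishes (rkernel A) degr p j.
Proof.
move=> h hst c cp cA cj c0.
have [|y [yp yj yE]] := kosz_exact degr j cp c0.
  move=> p0; apply: (hst p0); last exact: cA.
  by have [_] := homog_chain_row set0 cj; rewrite cards0 subn0.
have [||||b [bp bA bE]] := h (fun G => y G *m A).
- exact: sized_mulmx.
- by move=> G; exists (y G).
- exact: homog_chain_mulmx hA _ _ (yj cj).
- by move=> G; rewrite kosz_mulmx yE; apply: cA.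
have [t [tp tE]] := lift_sized bp bA.
exists (fun G => y G - dX t G); split.
- by apply: sizedB => //; apply: sized_kosz.
- move=> G; rewrite /rkernel mulmxBl -kosz_mulmx -(eq_kosz _ tE) bE subrr //.
by move=> G; rewrite koszB koszK subr0.
Qed.

End Shift.

End KoszulVanishing.

(** * Linear resolutions *)

Section SubspaceBasis.
Local Open Scope ring_scope.

(** [P] is an arbitrary predicate: a free family inside it is enlarged, by classical case
    distinction, until it spans; the dimension of the ambient space bounds the number of rounds. *)
Lemma subspace_basis (k : fieldType) M (P : 'rV[k]_M -> Prop) :
  exists q (B : 'M[k]_(q, M)),
    [/\ row_free B, forall i, P (row i B) & forall u, P u -> (u <= B)%MS].
Proof.
suff H e : forall q (B : 'M[k]_(q, M)), row_free B -> (forall i, P (row i B)) ->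
    (M - q <= e)%N -> exists q' (B' : 'M[k]_(q', M)),
    [/\ row_free B', forall i, P (row i B') & forall u, P u -> (u <= B')%MS].
  by apply: (H M 0%N 0); rewrite ?leq_subr // /row_free ?mxrank0 // => -[].
elim: e => [|e IH] q B Bf BP qe.
  exists q, B; split=> // u _; apply: submx_full.
  have qM : (q <= M)%N by rewrite -(eqP Bf) rank_leq_col.
  by rewrite /row_full (eqP Bf) eqn_leq qM -subn_eq0 -leqn0.
case: (classic (forall u, P u -> (u <= B)%MS)) => [Bs|nB]; first by exists q, B.
have [u nu] := not_all_ex_not _ _ nB; have [Pu uB] := imply_to_and _ _ nu.
have uB' : row_free (col_mx u B).
  rewrite /row_free eqn_leq rank_leq_row -addsmxE add1n -{1}(eqP Bf).
  have : (B < u + B)%MS by rewrite ltmxE addsmxSr addsmx_sub submx_refl andbT; apply/negP.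
  by rewrite ltmxErank => /andP[].
apply: (IH _ (col_mx u B)) => //; last first.
  by move: qe; clear; lia.
move=> i; case: (split_ordP i) => j ->.
  by rewrite rowKu; have -> : row j u = u by apply/rowP => t; rewrite mxE ord1.
by rewrite rowKd.
Qed.

End SubspaceBasis.

Section Linear.
Local Open Scope ring_scope.
Variables (k : fieldType) (n : nat).
Notation S := {mpoly k[n]}.
Notation V := ('I_n).
Implicit Types (G H : {set V}) (m : 'X_{1..n}) (p j d : nat).

Notation dX := (kosz (fun v : V => 'X_v : S)).

Section Coordinates.
Variables (r : nat) (deg : 'I_r -> nat) (d : nat).
Notation J := ('I_r * 'X_{1..n < d.+1})%type.

(** A k-basis of the rows with entries of degree at most d. All rows homogeneous of degree d are
    among them, so their generators can be found by linear algebra over k. *)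
Definition monomial_rows : 'M[S]_(#|{: J}|, r) :=
  \matrix_(i < #|{: J}|, t < r) if (enum_val i).1 == t then 'X_[(enum_val i).2] else 0.

Definition of_coords (u : 'rV[k]_#|{: J}|) : 'rV[S]_r :=
  map_mx (@mpolyC n k) u *m monomial_rows.

Lemma mcoeff_of_coords u t m : (of_coords u 0 t)@_m =
  if insub m is Some mb then u 0 (enum_rank (t, mb)) else 0.
Proof.
rewrite mxE raddf_sum /=.
have uE i : ((map_mx (@mpolyC n k) u) 0 i * monomial_rows i t)@_m =
    if ((enum_val i).1 == t) && (val (enum_val i).2 == m) then u 0 i else 0.
  rewrite !mxE mcoeffCM; case: eqP => _; last by rewrite mcoeff0 mulr0.
  by rewrite mcoeffX; case: eqP => _; rewrite ?mulr1 ?mulr0.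
rewrite (eq_bigr _ (fun i _ => uE i)) -big_mkcond; case: insubP => [mb _ e|nB].
  rewrite (big_pred1 (enum_rank (t, mb))) // => i /=; rewrite -e val_eqE.
  rewrite -(inj_eq enum_val_inj i) enum_rankK.
  by case: (enum_val i) => [t' m'] /=; rewrite xpair_eqE.
rewrite big_pred0 // => i; apply: contraNF nB => /andP[_ /eqP<-].
exact: bmdeg.
Qed.

Lemma of_coords_inj : injective of_coords.
Proof.
move=> u w e; apply/rowP => i; have := congr1 (fun v : 'rV[S]_r =>
  (v 0 (enum_val i).1)@_(val (enum_val i).2)) e.
rewrite !mcoeff_of_coords valK; case e' : (enum_val i) => [t m].
by rewrite -e' enum_valK.
Qed.

Lemma of_coords_onto v : homog_row deg d v -> exists u, v = of_coords u.
Proof.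
move=> vd; exists (\row_i (v 0 (enum_val i).1)@_(val (enum_val i).2)).
apply: rowmP => t m; rewrite mcoeff_of_coords; case: insubP => [mb _ <-|nB].
  by rewrite mxE enum_rankK.
by apply/eqP; apply: contraNT nB => /vd <-; rewrite ltnS leq_addr.
Qed.

Lemma homog_basis (Q : 'rV[S]_r -> Prop) : (forall v, Q v -> homog_row deg d v) ->
  exists q (A : 'M[S]_(q, r)), [/\ forall i, Q (row i A),
    forall v, Q v -> exists w : 'rV[k]_q, v = map_mx (@mpolyC n k) w *m A
  & forall w : 'rV[k]_q, map_mx (@mpolyC n k) w *m A = 0 -> w = 0].
Proof.
move=> Qd; have [q [B [Bf BQ Bs]]] := subspace_basis (fun u => Q (of_coords u)).
exists q, (map_mx (@mpolyC n k) B *m monomial_rows).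
have mB (w : 'rV[k]_q) : map_mx (@mpolyC n k) w *m (map_mx (@mpolyC n k) B *m monomial_rows) =
    of_coords (w *m B) by rewrite /of_coords map_mxM mulmxA.
split.
- by move=> i; rewrite row_mul -map_row; apply: BQ.
- move=> v Qv; have [u uE] := of_coords_onto (Qd _ Qv); rewrite uE in Qv *.
  by have /submxP[w ->] := Bs _ Qv; exists w; rewrite mB.
move=> w; rewrite mB => w0; have : of_coords (w *m B) = of_coords 0.
  by rewrite w0 /of_coords map_mx0 mul0mx.
by move=> /of_coords_inj wB; apply: (row_free_inj Bf); rewrite wB mul0mx.
Qed.

End Coordinates.

Definition linear_mod r (N : 'rV[S]_r -> Prop) (deg : 'I_r -> nat) d :=
  [/\ N 0, forall v w, N v -> N w -> N (v + w), forall (a : S) v, N v -> N (a *: v),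
      forall j v, N v -> N (row_part deg j v)
    & forall p j, j <> (p + d)%N -> koszul_vanishes N deg p j].

Lemma row_part_XM r (deg : 'I_r -> nat) j (u : V) (v : 'rV[S]_r) :
  row_part deg j ('X_u *: v) = if j is i.+1 then 'X_u *: row_part deg i v else 0.
Proof.
apply: rowmP => t m; rewrite mcoeff_row_part mxE mcoeff_XM.
have mE : (0 < m u)%N -> mdeg m = (mdeg (m - U_(u))%MM).+1.
  move=> mu; rewrite -{1}(@submK _ U_(u)%MM m) ?mdegD ?mdeg1 ?addn1 //.
  by apply/mnm_lepP => i; rewrite mnm1E; case: eqP => [<-|].
case: j => [|j].
  rewrite mxE mcoeff0; case: ifP => // /eqP e; case: ifP => // mu.
  by rewrite mE in e.
rewrite [in RHS]mxE !mcoeff_XM; have [mu|mu] := boolP (0 < m u)%N; last by rewrite if_same.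
by rewrite mcoeff_row_part mE // addSn eqSS.
Qed.

Lemma row_part_sum r (deg : 'I_r -> nat) (v : 'rV[S]_r) :
  exists B, v = \sum_(j < B) row_part deg j v.
Proof.
pose B := (\max_t (msize (v 0%R t) + deg t)%N).+1; exists B; apply: rowmP => t m.
rewrite summxE raddf_sum /=; have [vm|vm] := eqVneq ((v 0 t)@_m) 0.
  by rewrite vm big1 // => j _; rewrite mcoeff_row_part vm if_same.
have mB : (mdeg m + deg t < B)%N.
  rewrite ltnS; apply: leq_trans (leq_bigmax t); rewrite leq_add2r ltnW //.
  by rewrite msize_mdeg_lt // mcoeff_msupp.
rewrite (bigD1 (Ordinal mB)) //= big1 ?addr0 ?mcoeff_row_part ?eqxx // => j jB.
rewrite mcoeff_row_part; case: eqP => // e; case/eqP: jB; exact: val_inj.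
Qed.

(** A graded Nakayama lemma: outside degree d every homogeneous element is a combination of the
    variables with coefficients in [N], so induction on the degree ends in degree d or at zero. *)
Lemma linear_mod_generated r (N : 'rV[S]_r -> Prop) (deg : 'I_r -> nat) d q (A : 'M[S]_(q, r)) :
  linear_mod N deg d ->
  (forall v, N v -> homog_row deg d v -> rimage A v) ->
  forall v, N v -> rimage A v.
Proof.
move=> [N0 ND NZ Np Nk] Ad.
have AD v w : rimage A v -> rimage A w -> rimage A (v + w).
  by move=> [a ->] [b ->]; exists (a + b); rewrite mulmxDl.
have AZ (a : S) v : rimage A v -> rimage A (a *: v).
  by move=> [b ->]; exists (a *: b); rewrite scalemxAl.
have A0 : rimage A 0 by exists 0; rewrite mul0mx.
(* The element v, placed at the empty face, is a Koszul cycle; a filling lives on singletons and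
   exhibits v as a combination of the variables. *)
have gen j v : j <> d -> N v -> homog_row deg j v ->
    exists w, (forall u, N (w u)) /\ v = \sum_u 'X_u *: w u.
  move=> jd Nv vj; pose c (G : {set V}) := if G == set0 then v else 0.
  have c0 : sized 0 c.
    by move=> G; rewrite /c -cards_eq0; case: ifP => // _; rewrite eqxx.
  have [|||b [bp bN bE]] := Nk 0%N j jd c c0.
  - by move=> G; rewrite /c; case: ifP.
  - move=> G t m; rewrite /c; case: ifP => [/eqP-> /vj <-|_]; first by rewrite cards0 addn0.
    by rewrite mxE mcoeff0 eqxx.
  - by move=> G; apply: kosz_sized0.
  exists (fun u => osgn S u set0 *: b (u |: set0)); split=> [u|]; first exact: NZ.
  have := bE set0; rewrite /c eqxx => <-; apply: eq_big => [u|u _]; first by rewrite inE.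
  by rewrite scalerA mulrC.
have hom j v : N v -> homog_row deg j v -> rimage A v.
  elim: j v => [|j IH] v Nv vj.
    have [d0|d0] := eqVneq d 0%N; first by apply: Ad; rewrite ?d0.
    have [w [_ vE]] : exists w, (forall u, N (w u)) /\ v = \sum_u 'X_u *: w u.
      by apply: gen vj => // e; rewrite -e eqxx in d0.
    rewrite -(row_part_id vj) vE; elim/big_ind: _ => [|v1 v2|u _].
    - by rewrite row_part_eq0 // => t m; rewrite mxE mcoeff0 eqxx.
    - by rewrite row_partD; apply: AD.
    by rewrite row_part_XM.
  have [d0|/eqP d0] := eqVneq j.+1 d; first by apply: Ad; rewrite -?d0.
  have [w [Nw vE]] := gen _ _ d0 Nv vj.
  rewrite -(row_part_id vj) vE; elim/big_ind: _ => [|v1 v2|u _].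
  - by rewrite row_part_eq0 // => t m; rewrite mxE mcoeff0 eqxx.
  - by rewrite row_partD; apply: AD.
  by rewrite row_part_XM; apply/AZ/IH; [apply: Np | apply: row_part_homog].
move=> v Nv; have [B ->] := row_part_sum deg v.
by elim/big_ind: _ => // j _; apply: (hom j); [exact: Np | exact: row_part_homog].
Qed.

Lemma linear_mod_step r (N : 'rV[S]_r -> Prop) (deg : 'I_r -> nat) d :
  linear_mod N deg d -> exists q (A : 'M[S]_(q, r)),
    [/\ forall v, N v <-> rimage A v, homog_mx (fun=> d) deg A
      & linear_mod (rkernel A) (fun=> d) d.+1].
Proof.
move=> hN; have [N0 ND NZ Np Nk] := hN.
have [|q [A [AQ Aspan Afree]]] := @homog_basis r deg d (fun v => N v /\ homog_row deg d v).
  by move=> v [].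
have hA : homog_mx (fun=> d) deg A.
  by move=> t u m; have [_ /(_ u m)] := AQ t; rewrite mxE.
have NA v : N v <-> rimage A v.
  split=> [|[w ->]].
    apply: (linear_mod_generated hN) => {}v Nv vd.
    by have [w ->] := Aspan v (conj Nv vd); exists (map_mx (@mpolyC n k) w).
  rewrite mulmx_sum_row; elim/big_ind: _ => // t _; apply: NZ.
  by have [] := AQ t.
exists q, A; split=> //; split.
- by rewrite /rkernel mul0mx.
- by move=> v w vA wA; rewrite /rkernel mulmxDl vA wA addr0.
- by move=> a v vA; rewrite /rkernel -scalemxAl vA scaler0.
- move=> j v vA; rewrite /rkernel -(row_part_mulmx hA) vA row_part_eq0 // => t m.
  by rewrite mxE mcoeff0 eqxx.
move=> p j jp; apply: (koszul_vanishes_down hA).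
  apply: koszul_vanishes_iff NA _; apply: Nk => e; apply: jp; rewrite e; clear; lia.
(* All generators have degree d, so a homogeneous syzygy with a nonzero constant term is constant
   throughout: a linear relation over k between basis rows, hence zero. *)
move=> p0 v vj vA t; apply/eqP; apply: contraT => vt.
have dj : d = j by rewrite -(vj _ _ vt) mdeg0.
have vE : v = map_mx (@mpolyC n k) (\row_u (v 0 u)@_0).
  apply: rowmP => u m; rewrite !mxE mcoeffC; have [->|m0] := eqVneq m 0%MM.
    by rewrite mulr1.
  rewrite mulr0; apply/eqP; apply: contraNT m0 => /vj.
  by rewrite -dj -{2}[d]add0n => /addIn/eqP; rewrite mdeg_eq0.
have v0 : v = 0 by rewrite vE (Afree (\row_u (v 0 u)@_0)) ?map_mx0 // -vE.
by rewrite v0 mxE mcoeff0 eqxx in vt.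
Qed.

End Linear.

(** * Linear resolutions versus concentration of Koszul homology *)

Section Resolutions.
Local Open Scope ring_scope.
Variables (k : fieldType) (n : nat).
Notation S := {mpoly k[n]}.

Definition ideal_rows (I : S -> Prop) (v : 'rV[S]_1) := I (v 0 0).

Section FromResolution.
Variables (F : graded_free_seq k n) (I : S -> Prop).
Hypotheses (hF : gf_homogeneous F) (rF : gf_resolves F I).

Lemma gf_diff_homog i : homog_mx (@gf_deg _ _ F i.+1) (@gf_deg _ _ F i) (gf_diff F i).
Proof.
move=> t u m; rewrite -mcoeff_msupp => hm; have [/dhomogP h /(_ _)] := proj2 hF i t u.
rewrite (h _ hm) => le; rewrite subnK // le //.
by apply: contraTneq hm => ->; rewrite msupp0.
Qed.

Lemma gf_aug_homog : homog_mx (@gf_deg _ _ F 0) (fun=> 0%N) (gf_aug F).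
Proof.
move=> t u m; rewrite -mcoeff_msupp addn0 (ord1 u).
by have /dhomogP h := proj1 hF t; apply: h.
Qed.

(** After p shifts along the resolution, the base case applies to the image of the differential out
    of the free module with index (p + i) + 1. *)
Lemma koszul_vanishes_syzygy p j i : (forall t, @gf_deg _ _ F (p + i).+1 t != j) ->
  koszul_vanishes (rimage (gf_diff F i)) (@gf_deg _ _ F i) p j.
Proof.
elim: p i => [|p IH] i hj; first exact: (koszul_vanishes_base (@gf_diff_homog i)).
apply: (koszul_vanishes_up (@gf_diff_homog i)).
have [_ _ ex] := rF; apply: koszul_vanishes_iff (fun v => iff_sym (ex i v)) _.
by apply: IH; rewrite addnS.
Qed.

Lemma koszul_vanishes_resolved p j : (forall t, @gf_deg _ _ F p t != j) ->
  koszul_vanishes (ideal_rows I) (fun=> 0%N) p j.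
Proof.
have [hI h0 _] := rF => hj.
have II v : rimage (gf_aug F) v <-> ideal_rows I v.
  rewrite /ideal_rows hI /rimage {1}[v]mx11_scalar.
  by split=> -[w e]; exists w; rewrite e.
apply: koszul_vanishes_iff II _; case: p hj => [|p] hj.
  exact: (koszul_vanishes_base (@gf_aug_homog)).
apply: (koszul_vanishes_up (@gf_aug_homog)); apply: koszul_vanishes_iff (fun v => iff_sym (h0 v)) _.
by apply: koszul_vanishes_syzygy; rewrite addn0.
Qed.

End FromResolution.

Lemma linear_resolution_koszul_vanishes (I : S -> Prop) : has_linear_resolution I ->
  exists d, forall p j, j <> (p + d)%N -> koszul_vanishes (ideal_rows I) (fun=> 0%N) p j.
Proof.
move=> [d hd]; exists d => p j /hd[F [[hF rF _] e]].
apply: (koszul_vanishes_resolved hF rF) => t; apply/negP => tj.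
by have := cards0_eq (esym e) => /setP/(_ t); rewrite !inE tj.
Qed.

(** The ambient rank changes at every step; bundling it makes [syzygies] an endofunction that can be
    iterated. The resolution is an infinite sequence of data, so each presentation is chosen by a
    description axiom. *)
Record linear_submod := LinearSubmod {
  ls_rank : nat;
  ls_mem : 'rV[S]_ls_rank -> Prop;
  ls_deg : 'I_ls_rank -> nat;
  ls_d : nat;
  ls_linear : linear_mod ls_mem ls_deg ls_d
}.

Definition presents (N : linear_submod) (qA : {q : nat & 'M[S]_(q, ls_rank N)}) :=
  [/\ forall v, ls_mem v <-> rimage (projT2 qA) v,
      homog_mx (fun=> ls_d N) (@ls_deg N) (projT2 qA)
    & linear_mod (rkernel (projT2 qA)) (fun=> ls_d N) (ls_d N).+1].

Lemma ex_presents N : exists qA, @presents N qA.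
Proof.
by have [q [A hA]] := linear_mod_step (ls_linear N); exists (existT _ q A).
Qed.

Definition presentation N := proj1_sig (constructive_indefinite_description _ (ex_presents N)).

Lemma presentationP N : presents (presentation N).
Proof. exact: proj2_sig (constructive_indefinite_description _ (ex_presents N)). Qed.

Definition syzygies N : linear_submod :=
  @LinearSubmod (projT1 (presentation N)) _ _ _
    (let: And3 _ _ h := presentationP N in h).

Lemma linear_mod_resolution (I : S -> Prop) d :
  linear_mod (ideal_rows I) (fun=> 0%N) d -> has_linear_resolution I.
Proof.
move=> hI; pose N0 := LinearSubmod hI.
pose st i := iter i syzygies N0.
(* The index is shifted: [st i.+1] is the syzygy module inside the i-th free module, whose basis has
   degree [ls_d (st i)], that is i + d. *)
pose F := @GradedFreeSeq k n (fun i => ls_rank (st i.+1)) (fun i => @ls_deg (st i.+1))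
  (fun i => projT2 (presentation (st i.+1))) (projT2 (presentation N0)).
have dst i : ls_d (st i) = (i + d)%N by elim: i => //= i ->.
have degF i t : @gf_deg _ _ F i t = (i + d)%N by rewrite -dst.
have hA i t u m : (gf_diff F i t u)@_m != 0 -> mdeg m = 1%N.
  have [_ hA _] := presentationP (st i.+1) => /hA.
  change (@ls_deg (st i.+1) u) with (@gf_deg _ _ F i u).
  by rewrite degF dst; clear; lia.
have mF : minimal_graded_free_resolution F I.
  split.
  - split=> [t|i t u].
      apply/dhomogP => m; rewrite mcoeff_msupp degF add0n.
      have [_ h _] := presentationP N0; by move=> /h; rewrite addn0.
    rewrite !degF; split; last by rewrite addSn leqnSn.
    apply/dhomogP => m; rewrite mcoeff_msupp => /hA e; apply: etrans e _.
    by clear; lia.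
  - split.
    + move=> f; have [h _ _] := presentationP N0; have := h f%:M.
      rewrite /= /ideal_rows mxE eqxx mulr1n => ->.
      by split=> -[w e]; exists w.
    + by move=> v; have [h _ _] := presentationP (st 1%N); apply: h.
    move=> i v; have [h _ _] := presentationP (st i.+2); apply: h.
  by move=> i t u; apply/eqP; apply: contraT => /hA; rewrite mdeg0.
exists d => i j ij; exists F; split=> //; apply/esym/eqP; rewrite cards_eq0.
by apply/eqP/setP=> t; rewrite !inE degF eq_sym; apply/eqP.
Qed.

End Resolutions.

(** * Monomial ideals and the minimal ideal *)

Section MonomialIdeals.
Local Open Scope ring_scope.
Variables (k : fieldType) (n : nat).
Notation S := {mpoly k[n]}.
Notation V := ('I_n).
Implicit Types (G H : {set V}) (m : 'X_{1..n}) (p j d : nat).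

Variables (P : pred 'X_{1..n}) (I : S -> Prop).
Hypothesis P_up : forall m m', (m <= m')%MM -> P m -> P m'.
Hypothesis IP : forall f, I f <-> forall m, f@_m != 0 -> P m.

Lemma ideal_rowsP (v : 'rV[S]_1) : ideal_rows I v <-> forall m, (v 0 0)@_m != 0 -> P m.
Proof. exact: IP. Qed.

Lemma koszul_cpx_dclosed m : dclosed (koszul_cpx P m).
Proof.
move=> G H; rewrite !inE => /andP[/mnm_lepP Gm PG] /subsetP sH.
have le i : (mesym1 H i <= mesym1 G i)%N.
  by rewrite !mesym1E; case: (boolP (i \in H)) => // /sH->.
apply/andP; split; first by apply/mnm_lepP => i; apply: leq_trans (Gm i).
by apply: P_up PG; apply/mnm_lepP => i; rewrite !mnmBE leq_sub2l.
Qed.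

Lemma koszul_vanishes_monomial p j : koszul_vanishes (ideal_rows I) (fun=> 0%N) p j <->
  forall m, mdeg m = j -> reduced_homology_vanishes k (koszul_cpx P m) p.
Proof.
split=> [h m mj|h c cp cI cj c0].
  apply/vanishesP => z zK z0.
  (* Homogenizing z: the monomials are chosen so that z is the slice of c at m and all other slices
     are zero. *)
  pose c (G : {set V}) : S^o := if (mesym1 G <= m)%MM then z G *: 'X_[m - mesym1 G] else 0.
  have cE G q : (c G)@_q = if q == (m - mesym1 G)%MM then z G else 0.
    rewrite /c; case: ifPn => [Gm|Gm].
      by rewrite mcoeffZ mcoeffX eq_sym; case: eqP => _; rewrite ?mulr1 ?mulr0.
    rewrite mcoeff0; case: ifP => // _; apply/esym/eqP/contraT => /zK.
    by rewrite inE (negPf Gm).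
  have sE m' G : slice c m' G = if m' == m then z G else 0.
    rewrite /slice cE; case: ifPn => [Gm|Gm].
      have [->|m'm] := eqVneq m' m; first by rewrite eqxx.
      case: eqP => // e; case: (boolP (mesym1 G <= m)%MM) => Gm'.
        by case/eqP: m'm; rewrite -(submK Gm) e submK.
      by apply/eqP/contraT => /zK; rewrite inE (negPf Gm').
    case: eqP => // e; apply/esym/eqP/contraT => /zK; rewrite inE -e (negPf Gm) //.
  pose c' (G : {set V}) : 'rV[S]_1 := \row__ c G.
  have c'E G : c' G 0 0 = c G by rewrite mxE.
  have [||||b [bp bI bE]] := h c'.
  - move=> G /row_neq0[t [q]]; rewrite mxE cE; case: ifP => [_ /zK/andP[]//|_].
    by rewrite eqxx.
  - move=> G; apply/ideal_rowsP => q; rewrite c'E cE; case: ifP => [/eqP->|_]; last by rewrite eqxx.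
    by move=> /zK; rewrite inE => /andP[/andP[]].
  - move=> G t q; rewrite mxE cE addn0; case: ifP => [/eqP->|_]; last by rewrite eqxx.
    move=> /zK; rewrite inE => /andP[/andP[Gm _] _].
    by rewrite -(mdeg_mesym1 G) mdeg_sub.
  - move=> G; apply/rowP => t; rewrite kosz_entry mxE (ord1 t).
    have c0 : kosz (fun v : V => 'X_v : S) c =1 (fun=> 0 : S^o).
      apply: sliceP => m' H; rewrite slice_kosz (eq_kosz _ (sE m')) /slice mcoeff0 if_same.
      by case: eqP => _; [apply: z0 | apply: kosz0].
    by rewrite -(c0 G); apply: eq_bigr => v _; rewrite c'E.
  exists (slice (fun G => b G 0 0 : S^o) m).
    move=> G; rewrite /slice inE; case: ifP => [Gm h'|]; last by rewrite eqxx.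
    have /ideal_rowsP -> // := bI G; rewrite bp //.
    by apply: contraNneq h' => ->; rewrite mxE mcoeff0.
  have zE G : z G = slice c m G by rewrite sE eqxx.
  by move=> G; rewrite -slice_kosz zE /slice -kosz_entry bE c'E.
have [||||b [bp bP bc]] := @kosz_fill _ _ P (fun G => c G 0 0 : S^o) p.
- by move=> G e; apply: cp; apply: contraNneq e => ->; rewrite mxE.
- by move=> G; apply/ideal_rowsP/cI.
- by move=> G; rewrite -kosz_entry c0 mxE.
- move=> m G /slice_neq0_deg[q /cj + e]; rewrite addn0 e; exact: h.
exists (fun G => \row__ b G); split.
- move=> G /row_neq0[t [q]]; rewrite mxE => e; apply: bp.
  by apply: contraNneq e => ->; rewrite mcoeff0.
- by move=> G; apply/ideal_rowsP => m; rewrite mxE => /bP[].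
move=> G; apply/rowP => t; rewrite (ord1 t) kosz_entry -bc.
by apply: eq_bigr => v _; rewrite mxE.
Qed.

Lemma linear_mod_monomial d :
  (forall p j, j <> (p + d)%N -> koszul_vanishes (ideal_rows I) (fun=> 0%N) p j) ->
  linear_mod (ideal_rows I) (fun=> 0%N) d.
Proof.
move=> h; split=> // [|v w /ideal_rowsP vP /ideal_rowsP wP|a v /ideal_rowsP vP|
  j v /ideal_rowsP vP]; apply/ideal_rowsP => m.
- by rewrite mxE mcoeff0 eqxx.
- rewrite mxE mcoeffD; have [e|/vP//] := eqVneq ((v 0 0)@_m) 0.
  by rewrite e add0r => /wP.
- rewrite mxE -mcoeff_msupp => /msuppM_le /allpairsP[[m1 m2] [/= _]].
  by rewrite mcoeff_msupp => /vP Pm2 ->; apply: P_up Pm2; apply: lem_addl.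
by rewrite mcoeff_row_part; case: ifP => [_ /vP|_]; rewrite ?eqxx.
Qed.

Lemma linear_resolution_monomial :
  has_linear_resolution I <-> exists d, forall m p, mdeg m <> (p + d)%N ->
    reduced_homology_vanishes k (koszul_cpx P m) p.
Proof.
split=> [/linear_resolution_koszul_vanishes[d h]|[d h]].
  by exists d => m p /h /koszul_vanishes_monomial; apply.
apply: (@linear_mod_resolution _ _ _ d); apply: linear_mod_monomial => p j jp.
by apply/koszul_vanishes_monomial => m mj; apply: h; rewrite mj.
Qed.

End MonomialIdeals.

(** * Koszul complexes of the ideal of the lattice *)

Section MinimalIdeal.
Local Open Scope ring_scope.
Variables (k : fieldType) (disp : Order.disp_t) (T : finTBLatticeType disp).
Notation n := #|meet_irr T|.
Notation f := (@enum_val T (mem (meet_irr T))).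
Implicit Types (a t x : T) (G : {set 'I_n}) (m : 'X_{1..n}).

Lemma enum_val_sep x y : y != \bot%O -> ~~ (x <= y)%O ->
  exists2 i : 'I_n, (y <= f i)%O & ~~ (x <= f i)%O.
Proof.
move=> y0 xy; have [l [lM yl xl]] := meet_irr_sep y0 xy.
by exists (enum_rank_in lM l); rewrite enum_rankK_in.
Qed.

Definition xsupp a : {set 'I_n} := [set i | ~~ (a <= f i)%O].

Lemma card_xsupp a : #|xsupp a| = ht a.
Proof.
rewrite -(card_imset _ (@enum_val_inj _ _)); apply: eq_card => l; rewrite in_mi_notabove.
apply/imsetP/andP => [[i]|[lM al]]; first by rewrite inE => ai ->; rewrite enum_valP.
by exists (enum_rank_in lM l); rewrite ?inE enum_rankK_in.
Qed.

Lemma xmonE a : xmon k a = 'X_[mesym1 (xsupp a)].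
Proof.
rewrite mpolyXE_id /xmon big_mkcond; apply: eq_bigr => i _.
by rewrite mesym1E inE; case: ifP; rewrite ?expr1 ?expr0.
Qed.

Lemma total_degree_xmon a : total_degree (xmon k a) = ht a.
Proof. by rewrite /total_degree xmonE msizeX mdeg_mesym1 card_xsupp. Qed.

Definition in_minimal m := [exists a : T, atom a && (mesym1 (xsupp a) <= m)%MM].

Lemma in_minimal_up m m' : (m <= m')%MM -> in_minimal m -> in_minimal m'.
Proof.
move=> mm /existsP[a /andP[aA am]]; apply/existsP; exists a.
by rewrite aA (lepm_trans am).
Qed.

Lemma minimal_idealP g : minimal_ideal k T g <-> forall m, g@_m != 0 -> in_minimal m.
Proof.
split=> [[s [/allP sA ->]] m|h].
  rewrite -mcoeff_msupp => /msupp_sum_le /flattenP[l /mapP[[c q]]].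
  rewrite mem_filter /= => cqs ->; have /existsP[a /andP[aA /eqP qE]] := sA _ cqs.
  move=> /msuppM_le /allpairsP[[m1 m2] [/= _]]; rewrite [q]qE xmonE msuppX inE => /eqP-> ->.
  by apply/existsP; exists a; rewrite aA lem_addl.
(* An atom whose monomial divides m; for m in the support of g the default value never occurs. *)
pose pa m : T := odflt \bot%O [pick a | atom a && (mesym1 (xsupp a) <= m)%MM].
have paP m : m \in msupp g -> atom (pa m) && (mesym1 (xsupp (pa m)) <= m)%MM.
  rewrite mcoeff_msupp => /h /existsP[a aP]; rewrite /pa.
  by case: pickP => [//|/(_ a)]; rewrite aP.
exists [seq (g@_m *: 'X_[m - mesym1 (xsupp (pa m))], xmon k (pa m)) | m <- msupp g]; split.
  apply/allP => _ /mapP[m mg ->] /=; apply/existsP; exists (pa m).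
  by have /andP[-> _] := paP _ mg; rewrite eqxx.
rewrite big_map {1}[g]mpolyE big_seq [RHS]big_seq; apply: eq_bigr => m mg /=.
by rewrite xmonE -scalerAl -mpolyXD submK //; have /andP[] := paP _ mg.
Qed.

(** For an atom a, x(a) divides x(t) with the variables of G removed exactly when a is below t and
    below [f i] for all i in G. So a is a nonzero lower bound, and conversely each such bound lies
    above an atom. *)
Lemma koszul_cpx_xsupp t : t != \bot%O ->
  koszul_cpx in_minimal (mesym1 (xsupp t)) = lower_bounded f t.
Proof.
move=> t0; apply/setP=> G; rewrite inE; apply/andP/lower_boundedP.
  move=> [/mnm_lepP Gt /existsP[a /andP[aA /mnm_lepP am]]].
  have am' i : ~~ (a <= f i)%O -> ~~ (t <= f i)%O && (i \notin G).
    have := am i; rewrite mnmBE !mesym1E !inE.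
    by case: (_ <= _)%O; case: (_ <= _)%O; case: (_ \in _).
  split=> [i iG|]; first by have := Gt i; rewrite !mesym1E iG inE; case: (_ <= _)%O.
  exists a; split; first exact: atom_neq0.
    apply: contraT => /(enum_val_sep t0)[i ti /am' /andP[]]; by rewrite ti.
  by move=> i iG; apply: contraT => /am' /andP[_]; rewrite iG.
move=> [Gt [x [x0 xt xG]]]; split.
  by apply/mnm_lepP => i; rewrite !mesym1E inE; case: (boolP (i \in G)) => // /Gt->.
have [a aA ax] := ex_atom x0; apply/existsP; exists a; rewrite aA.
apply/mnm_lepP => i; rewrite mnmBE !mesym1E !inE; case: (boolP (a <= f i)%O) => // ai.
have -> : (t <= f i)%O = false.
  by apply: contraNF ai => ti; rewrite (le_trans ax) // (le_trans xt).
have -> // : i \in G = false.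
by apply: contraNF ai => /xG; apply: le_trans.
Qed.

(** The generators are squarefree, so after removing one factor ['X_l] from m the remaining one
    still suffices: l is an apex. *)
Lemma vanishes_koszul_apex m l p : (1 < m l)%N ->
  reduced_homology_vanishes k (koszul_cpx in_minimal m) p.
Proof.
move=> ml; apply: (@vanishes_apex _ _ _ l); first exact/koszul_cpx_dclosed/in_minimal_up.
move=> G; rewrite !inE => /andP[/mnm_lepP Gm /existsP[a /andP[aA /mnm_lepP am]]].
have lE i : mesym1 (l |: G) i = (if i == l then 1 else mesym1 G i)%N.
  by rewrite !mesym1E !inE; case: (i =P l) => [->|].
apply/andP; split.
  by apply/mnm_lepP => i; rewrite lE; case: eqP => [->|_]; rewrite ?Gm // ltnW.
apply/existsP; exists a; rewrite aA; apply/mnm_lepP => i; rewrite mnmBE lE.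
case: eqP => [->|_]; last by have := am i; rewrite mnmBE.
by rewrite mesym1E (leq_trans (leq_b1 _)) // ltn_subRL.
Qed.

Lemma koszul_acyclic_intervals d :
  (forall m p, mdeg m <> (p + d)%N -> reduced_homology_vanishes k (koszul_cpx in_minimal m) p)
  <-> acyclic_intervals k T d.
Proof.
have vt t p : t != \bot%O ->
    reduced_homology_vanishes k (koszul_cpx in_minimal (mesym1 (xsupp t))) p <->
    reduced_homology_vanishes k (order_complex (ival \bot%O t)) p.
  by move=> t0; rewrite koszul_cpx_xsupp //; apply: vanishes_lower_bounded; first exact: enum_val_sep.
split=> [h t t0 p tp|h m p mp].
  by apply/vt => //; apply: h; rewrite mdeg_mesym1 card_xsupp.
have [/existsP[l ml]|] := boolP [exists l, (1 < m l)%N]; first exact: vanishes_koszul_apex ml.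
rewrite negb_exists => /forallP sqf.
pose s : {set 'I_n} := [set i | (0 < m i)%N].
have mE : m = mesym1 s.
  apply/mnmP => i; rewrite mesym1E inE; have := sqf i.
  by case: (m i) => [|[]].
(* The largest element whose monomial divides m. If x(t) is a proper divisor of m, an index of the
   quotient is an apex; if t is the bottom, no atom divides m and there are no faces. *)
pose t : T := (\meet_(i in ~: s) f i)%O.
have bP a : (mesym1 (xsupp a) <= m)%MM = (a <= t)%O.
  apply/mnm_lepP/meetsP => [h' i|h' i].
    rewrite !inE => is0; apply: contraT => ai; have := h' i.
    by rewrite mE !mesym1E !inE ai (negPf is0).
  rewrite mE !mesym1E inE; case: (boolP (i \in s)) => [_|is0]; first exact: leq_b1.
  by rewrite h' // inE.
have [t0|t0] := eqVneq t \bot%O.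
  apply: vanishes_size => G; rewrite inE => /andP[_ /existsP[a /andP[aA am]]].
  have : (mesym1 (xsupp a) <= m)%MM by apply: lepm_trans am (lem_subr _ _).
  by rewrite bP t0 lex0 (negPf (atom_neq0 aA)).
have st : xsupp t \subset s.
  apply/subsetP => i; rewrite inE; apply: contraNT => is0; apply: meets_inf.
  by rewrite inE.
have [se|[l ls lt]] : s = xsupp t \/ exists2 l, l \in s & (t <= f l)%O.
  have [/subsetP sx|/subsetPn[l ls]] := boolP (s \subset xsupp t).
    by left; apply/eqP; rewrite eqEsubset st andbT; apply/subsetP.
  by rewrite inE negbK => lt; right; exists l.
  by rewrite mE se; apply/vt => //; apply: h => //; rewrite -card_xsupp -se -mdeg_mesym1 -mE.
(* All atoms whose monomials divide m are below t, hence below [f l]; the variable l occurs in none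
   of these monomials and can be removed freely. *)
apply: (@vanishes_apex _ _ _ l); first exact/koszul_cpx_dclosed/in_minimal_up.
move=> G; rewrite !inE => /andP[/mnm_lepP Gm /existsP[a /andP[aA am]]].
have at' : (a <= t)%O by rewrite -bP; apply: lepm_trans am (lem_subr _ _).
apply/andP; split.
  apply/mnm_lepP => i; rewrite mesym1E !inE; case: eqP => [->|_] /=.
    by rewrite mE mesym1E ls.
  by have := Gm i; rewrite mesym1E.
apply/existsP; exists a; rewrite aA; apply/mnm_lepP => i.
have /mnm_lepP/(_ i) := am; rewrite !mnmBE !mesym1E !inE; case: (i =P l) => [->|//].
by rewrite (le_trans at' lt).
Qed.

End MinimalIdeal.

Theorem theorem5p8 (k : fieldType) (disp : Order.disp_t)
    (T : finTBLatticeType disp) (hT : atomic_lattice T) :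
  has_linear_resolution (minimal_ideal k T) <->
  (cohen_macaulay_poset k (proper_part T) /\
   forall a b : T, covers b a -> a <> (\bot)%O ->
     total_degree (xmon k b) = (total_degree (xmon k a)).+1).
Proof.
rewrite (linear_resolution_monomial (@in_minimal_up _ T) (@minimal_idealP k _ T)).
have eqd : (exists d, forall m p, mdeg m <> (p + d)%N ->
      reduced_homology_vanishes k (koszul_cpx (@in_minimal _ T) m) p) <->
    exists d, acyclic_intervals k T d.
  by split=> -[d h]; exists d; apply/koszul_acyclic_intervals.
rewrite eqd (acyclic_intervalsP _ hT); split=> -[cm h]; split=> // a b ab a0.
  by rewrite !total_degree_xmon; apply: h => //; apply/eqP.
by have := h a b ab; rewrite !total_degree_xmon; apply; apply/eqP.
Qed.
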